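(* In the setting of the context, let $\mathcal{C}_h:L^2(\Omega)\to\mathbb{P}^1(\mathcal{T}_h)\cap H^1_0(\Omega)$ be a bounded linear map, and define $\delta_h(u)\in V_h'$ by $\langle\delta_h(u),v_h\rangle_{V_h',V_h}:=a_h(\Pi_hu,v_h)-a(u,\mathcal{C}_h\mathsf{p}(v_h))$ for $v_h\in V_h$. Then for all $m\ge1$, $$\frac{C_{\mathrm{coerc}}}{8C_{\mathsf{p}}^2}\|\mathsf{p}(u_h^m)-u\|_{\mathrm{DG}}^2+\frac{(\mathcal{D}(u,o_h^m),1)}{\sum_{k=1}^m\alpha_k}\le\frac{(\mathcal{D}(u,o_h^0),1)}{\sum_{k=1}^m\alpha_k}+\frac1{C_{\mathrm{coerc}}}\|\delta_h(u)\|_{V_h'}^2+e_K(u_h^m)+e_h(u)+\frac{C_{\mathrm{coerc}}}{4C_{\mathsf{p}}^2}\|u-J_hu\|_{\mathrm{DG}}^2,$$ where $$e_K(u_h^m):=\inf_{v\in K}\big\{|a(u,\mathcal{C}_h\mathsf{p}(u_h^m)-v)-(f,\mathsf{p}(u_h^m)-v)|\big\},\qquad e_h(u):=|a(u,\mathcal{C}_hJ_hu-u)-(f,J_hu-u)|.$$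
   Context: Problem data. $\Omega\subset\mathbb{R}^n$, $n\in\{2,3\}$, is an open bounded Lipschitz domain, $(\cdot,\cdot)$ is the $L^2(\Omega)$ inner product, $f\in L^2(\Omega)$, and $\phi\in H^1(\Omega)\cap C^0(\overline\Omega)$ with $\phi\le 0$ on $\partial\Omega$. $K:=\{v\in H^1_0(\Omega): v\ge\phi\text{ a.e. in }\Omega\}$, $a(w,v):=(\nabla w,\nabla v)$, and $u\in K$ is the unique solution of $a(u,v-u)\ge(f,v-u)$ for all $v\in K$. Set $\mathcal{O}:=\{o\in L^2(\Omega): o(x)\in[\phi(x),\infty)\text{ for a.e. }x\}$. Legendre function. $R:\Omega\times\mathbb{R}\to\mathbb{R}\cup\{+\infty\}$ is a Carathéodory function such that for a.e. $x$ the map $R(x,\cdot)$ is a Legendre function with essential domain $[\phi(x),\infty)$ (proper, strictly convex, differentiable on the interior of its essential domain, with gradient singular only at the boundary of the domain) and supercoercive ($R(x,y)/|y|\to\infty$ as $|y|\to\infty$). $R^*(x,z):=\sup_{y\in\mathbb{R}}\{zy-R(x,y)\}$ is the convex conjugate, continuously differentiable and strictly convex in $z$. Superposition operators: $\mathcal{R}(w)(x):=R(x,w(x))$, $\nabla\mathcal{R}(w)(x):=\partial_yR(x,w(x))$, $\mathcal{R}^*(\psi)(x):=R^*(x,\psi(x))$, $\nabla\mathcal{R}^*(\psi)(x):=\partial_zR^*(x,\psi(x))$. Standing facts: $\nabla\mathcal{R}^*=(\nabla\mathcal{R})^{-1}$; $\nabla\mathcal{R}^*$ maps $L^\infty(\Omega)$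 into $\mathcal{O}$ with $\nabla\mathcal{R}^*(\psi)>\phi$ a.e., is continuous on $L^\infty(\Omega)$ and strictly monotone. Bregman divergence: $\mathcal{D}(w,v):=\mathcal{R}(w)-\mathcal{R}(v)-\nabla\mathcal{R}(v)(w-v)$ pointwise a.e. (which is $\ge0$), for $w$ in the domain of $\mathcal{R}$ and $v$ in the domain of $\nabla\mathcal{R}$. Mesh and spaces. $\mathcal{T}_h$ is a conforming shape-regular simplicial partition of $\Omega$, with interior facets $\mathcal{F}_h$ and boundary facets $\mathcal{F}_h^\partial$; $h_F$ is the diameter of $F$; $[v]$ is the jump of $v$ across an interior facet and its trace on a boundary facet. $H^1(\mathcal{T}_h)$ is the broken $H^1$-space, $\|v\|_{\mathrm{DG}}^2:=\sum_{T\in\mathcal{T}_h}\|\nabla v\|_{L^2(T)}^2+\sum_{F\in\mathcal{F}_h\cup\mathcal{F}_h^\partial}h_F^{-1}\|[v]\|_{L^2(F)}^2$, and $\mathbb{P}^p(\mathcal{T}_h)$ is the space of functions that are polynomials of degree at most $p$ on each $T$. Abstract discretization. $V_h$ is a finite-dimensional real vector space with norm $\|\cdot\|_{V_h}$ (dual $V_h'$ with dual norm), $W_h:=\mathbb{P}^0(\mathcal{T}_h)$, $V_{\mathcal{T}_h}$ is a space with $\mathbb{P}^0(\mathcal{T}_h)\subseteq V_{\mathcal{T}_h}\subseteq\mathbb{P}^1(\mathcal{T}_h)$, $\mathsf{p}:V_h\to V_{\mathcal{T}_h}$ is linear with $W_h\subseteq\mathsf{p}(V_h)$, and $a_h:V_h\times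 V_h\to\mathbb{R}$ is a symmetric bilinear form. Assume there are positive constants such that: (i) $a_h(v_h,v_h)\ge C_{\mathrm{coerc}}\|v_h\|_{V_h}^2$ and $a_h(v_h,z_h)\le C_{\mathrm{cont}}\|v_h\|_{V_h}\|z_h\|_{V_h}$ for all $v_h,z_h\in V_h$; (ii) $\|\mathsf{p}(v_h)\|_{\mathrm{DG}}\le C_{\mathsf{p}}\|v_h\|_{V_h}$ for all $v_h\in V_h$; (iii) there is a linear map $\Pi_h:H^1(\mathcal{T}_h)\to V_h$ such that, with $J_h:=\mathsf{p}\circ\Pi_h$, for all $v\in H^1(\mathcal{T}_h)$: $(J_hv-v,w_h)=0$ for all $w_h\in W_h$, and $\|\Pi_hv\|_{V_h}\le C_\Pi\|v\|_{\mathrm{DG}}$. Iterates. Let $\psi_h^0\in W_h$ and let $(\alpha_k)_{k\ge1}$ be positive reals with $\sum_k\alpha_k=\infty$. For $k\ge1$, $(u_h^k,\psi_h^k)\in V_h\times W_h$ is the unique solution of $a_h(u_h^k,v_h)+\frac1{\alpha_k}(\mathsf{p}(v_h),\psi_h^k-\psi_h^{k-1})=(f,\mathsf{p}(v_h))$ for all $v_h\in V_h$ and $(\mathsf{p}(u_h^k),w_h)=(\nabla\mathcal{R}^*(\psi_h^k),w_h)$ for all $w_h\in W_h$. Set $o_h^k:=\nabla\mathcal{R}^*(\psi_h^k)$ for $k\ge0$. *)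

(* Defs.v *)
From HB Require Import structures.
From mathcomp Require Import all_boot all_order all_algebra.
From mathcomp Require Import all_classical all_reals all_analysis measurable_realfun.
Set Implicit Arguments.
Unset Strict Implicit.
Unset Printing Implicit Defensive.
Import Order.TTheory GRing.Theory Num.Theory.
Import numFieldNormedType.Exports.
Local Open Scope classical_set_scope.
Local Open Scope ring_scope.

(* R^n = 'rV[R]_n carries the product of the Borel sigma-algebras of R. *)
Definition rV_display : measure_display. Proof. exact: default_measure_display. Qed.

Section rV_measurable.
Context (R : realType) (n : nat).
Let coord (i : 'I_n) (x : 'rV[R]_n) : R := x 0 i.
Let rV_set0 : g_sigma_preimage coord set0.
Proof. exact: sigma_algebra0. Qed.
Let rV_setC A : g_sigma_preimage coord A -> g_sigma_preimage coord (~` A).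
Proof. exact: sigma_algebraC. Qed.
Let rV_bigcup (F : (set _)^nat) : (forall i, g_sigma_preimage coord (F i)) ->
  g_sigma_preimage coord (\bigcup_i (F i)).
Proof. exact: sigma_algebra_bigcup. Qed.
HB.instance Definition _ := @isMeasurable.Build rV_display 'rV[R]_n
  (g_sigma_preimage coord) rV_set0 rV_setC rV_bigcup.
End rV_measurable.

Section leb_step.
Context (R : realType) (n : nat).
Variable m : {sigma_finite_measure set 'rV[R]_n -> \bar R}.

Definition rV_cons (p : R * 'rV[R]_n) : 'rV[R]_n.+1 :=
  \row_i (if unlift ord0 i is Some j then p.2 0 j else p.1).

Lemma measurable_coord k (i : 'I_k) :
  measurable_fun [set: 'rV[R]_k] (fun x => x 0 i).
Proof.
move=> _ Y mY; rewrite setTI; apply: sub_sigma_algebra => /=.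
rewrite -bigcup_seq/=; exists i => /=; first by rewrite mem_index_enum.
by exists Y => //; rewrite setTI.
Qed.

Lemma measurable_rV d (T : measurableType d) k (f : T -> 'rV[R]_k) :
  (forall i, measurable_fun [set: T] (fun x => f x 0 i)) ->
  measurable_fun [set: T] f.
Proof.
move=> mf.
suff H : g_sigma_preimage (fun i x => f x 0 i) `<=` @measurable d T.
  move=> _ A mA; rewrite setTI; apply: H.
  have -> : (fun i x => f x 0 i) = (fun i : 'I_k => (fun x : 'rV[R]_k => x 0 i) \o f) by [].
  by rewrite g_sigma_preimage_comp; exists A => //; rewrite setTI.
apply: smallest_sub; first exact: sigma_algebra_measurable.
move=> A; rewrite -bigcup_seq => -[i _ [B mB <-]]; exact: mf.
Qed.

Lemma measurable_rV_cons : measurable_fun [set: R * 'rV[R]_n] rV_cons.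
Proof.
apply: measurable_rV => i; case: (unliftP ord0 i) => [j|] ->.
  rewrite (_ : (fun x => _) = (fun x : 'rV[R]_n => x 0 j) \o snd).
    exact: measurableT_comp (measurable_coord _) _.
  by apply/funext => x /=; rewrite mxE liftK.
rewrite (_ : (fun x => _) = fst); first exact: measurable_fst.
by apply/funext => x /=; rewrite mxE unlift_none.
Qed.

Definition leb_succ := pushforward (lebesgue_measure \x m)%E rV_cons.

Let preim (A : set 'rV[R]_n.+1) : measurable A -> measurable (rV_cons @^-1` A).
Proof. by move=> mA; rewrite -[X in measurable X]setTI; exact: measurable_rV_cons. Qed.

Let leb_succ0 : leb_succ set0 = 0%E.
Proof. by rewrite /leb_succ /pushforward preimage_set0 measure0. Qed.

Let leb_succ_ge0 A : (0 <= leb_succ A)%E.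
Proof. by rewrite /leb_succ /pushforward measure_ge0. Qed.

Let leb_succ_sigma_additive : semi_sigma_additive leb_succ.
Proof.
move=> F mF tF mUF; rewrite /leb_succ /pushforward preimage_bigcup.
apply: measure_semi_sigma_additive.
- by move=> k; exact: preim.
- apply/trivIsetP => /= i j _ _ ij; rewrite -preimage_setI.
  by move/trivIsetP : tF => /(_ _ _ _ _ ij) ->//; rewrite preimage_set0.
- by rewrite -preimage_bigcup; exact: preim.
Qed.

HB.instance Definition _ := isMeasure.Build _ _ _ leb_succ
  leb_succ0 leb_succ_ge0 leb_succ_sigma_additive.

Let rV_uncons (x : 'rV[R]_n.+1) : R * 'rV[R]_n :=
  (x 0 ord0, \row_j x 0 (lift ord0 j)).

Let rV_consK : cancel rV_cons rV_uncons.
Proof.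
move=> [t x]; rewrite /rV_uncons /rV_cons; congr pair; first by rewrite mxE unlift_none.
by apply/rowP => j; rewrite !mxE liftK.
Qed.

Let measurable_rV_uncons : measurable_fun [set: 'rV[R]_n.+1] rV_uncons.
Proof.
apply: measurable_fun_pair; first exact: measurable_coord.
apply: measurable_rV => j.
rewrite (_ : (fun x => _) = (fun x : 'rV[R]_n.+1 => x 0 (lift ord0 j))).
  exact: measurable_coord.
by apply/funext => x; rewrite mxE.
Qed.

Let leb_succ_sigma_finite : sigma_finite setT leb_succ.
Proof.
have /sigma_finiteP[F [TF ndF Foo]] := sigma_finiteT (@lebesgue_measure R).
have /sigma_finiteP[G [TG ndG Goo]] := sigma_finiteT m.
exists (fun k => rV_uncons @^-1` (F k `*` G k)).
  apply/esym; rewrite -preimage_bigcup -subTset => x _ /=.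
  have [i _ Fi] : (\bigcup_i F i) (rV_uncons x).1 by rewrite -TF.
  have [j _ Gj] : (\bigcup_i G i) (rV_uncons x).2 by rewrite -TG.
  exists (maxn i j) => //; split.
  - by move: Fi; exact/subsetPset/ndF/leq_maxl.
  - by move: Gj; exact/subsetPset/ndG/leq_maxr.
move=> k; have [mF Fk] := Foo k; have [mG Gk] := Goo k; split.
  rewrite -[X in measurable X]setTI; apply: measurable_rV_uncons => //.
  exact: measurableX.
rewrite /leb_succ /pushforward -comp_preimage (_ : _ \o _ = id) ?preimage_id.
  by rewrite product_measure1E// lte_mul_pinfty// ge0_fin_numE.
by apply/funext => x /=; exact: rV_consK.
Qed.

HB.instance Definition _ := Measure_isSigmaFinite.Build _ _ _ leb_succ
  leb_succ_sigma_finite.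

Definition lebesgue_succ : {sigma_finite_measure set 'rV[R]_n.+1 -> \bar R} :=
  leb_succ.
End leb_step.

(* n-dimensional Lebesgue measure: iterated product of the measure on R *)
Fixpoint leb (R : realType) (n : nat) :
    {sigma_finite_measure set 'rV[R]_n -> \bar R} :=
  if n is k.+1 then lebesgue_succ (leb R k) else dirac (0 : 'rV[R]_0).

Section euclidean.
Context (R : realType) (n : nat).
Implicit Types (x y : 'rV[R]_n) (A D : set 'rV[R]_n).

Definition dotv x y : R := \sum_i x 0 i * y 0 i.
Definition enorm x : R := Num.sqrt (dotv x x).
Definition diam A : R := sup [set enorm (x - y) | x in A & y in A].

(* Near each boundary point, Omega is the strict epigraph, in some unit
   direction e, of a Lipschitz function of the component orthogonal to e. *)
Definition lipschitz_boundary (Omega : set 'rV[R]_n) : Prop :=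
  forall x, (closure Omega `\` Omega) x ->
  exists (e : 'rV[R]_n) (g : 'rV[R]_n -> R) (L r : R),
    [/\ enorm e = 1, 0 < r,
        forall y z, `|g y - g z| <= L * enorm (y - z) &
        forall y, enorm (y - x) < r ->
          (Omega y <-> g (y - dotv y e *: e) < dotv y e)].

Definition ae_on D (P : 'rV[R]_n -> Prop) : Prop :=
  {ae leb R n, forall x, D x -> P x}.

End euclidean.

(* Elements of L^2, H^1, ... are represented by Borel functions on R^n; only
   their values almost everywhere on the domain matter. *)
Section sobolev.
Context (R : realType) (n : nat).
Implicit Types (v w z : 'rV[R]_n -> R) (g : 'rV[R]_n -> 'rV[R]_n).
Implicit Types D : set 'rV[R]_n.

Definition L2 D v : Prop :=
  measurable_fun D v /\
  (leb R n).-integrable D (fun x => (v x ^+ 2)%:E).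

Definition Linfty D v : Prop :=
  measurable_fun D v /\ exists C : R, ae_on D (fun x => `|v x| <= C).

Definition ip D v w : R := \int[leb R n]_(x in D) (v x * w x).

Definition pderiv (i : 'I_n) v : 'rV[R]_n -> R :=
  fun x => 'D_(delta_mx 0 i) v x.

Definition grad v : 'rV[R]_n -> 'rV[R]_n := fun x => \row_i pderiv i v x.

Fixpoint Ck (k : nat) v : Prop :=
  continuous v /\
  if k is k'.+1 then
    forall i : 'I_n, (forall x, derivable v x (delta_mx 0 i)) /\
                     Ck k' (pderiv i v)
  else True.

Definition smooth v : Prop := forall k, Ck k v.

Definition test_fun D v : Prop :=
  [/\ smooth v, compact (closure [set x | v x != 0]) &
      closure [set x | v x != 0] `<=` D].

Definition is_wgrad D v g : Prop :=
  (forall i, L2 D (fun x => g x 0 i)) /\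
  forall z, test_fun D z -> forall i,
    ip D v (pderiv i z) = - ip D (fun x => g x 0 i) z.

Definition H1 D v : Prop := L2 D v /\ exists g, is_wgrad D v g.

(* A chosen representative of the weak gradient. *)
Definition wgrad D v : 'rV[R]_n -> 'rV[R]_n :=
  xget (fun=> 0) [set g | is_wgrad D v g].

Definition adir D w v : R :=
  \int[leb R n]_(x in D) dotv (wgrad D w x) (wgrad D v x).

Definition H1sqr D v : R := ip D v v + adir D v v.

(* squared H^1(D)-distance from a smooth function z to v *)
Definition H1dist_sqr D z v : R :=
  ip D (z \- v) (z \- v) +
  \int[leb R n]_(x in D) dotv (grad z x - wgrad D v x) (grad z x - wgrad D v x).

Definition H10 D v : Prop :=
  H1 D v /\
  exists z : nat -> 'rV[R]_n -> R,
    (forall j, test_fun D (z j)) /\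
    (fun j => H1dist_sqr D (z j) v) @ \oo --> (0 : R).

Definition poly_fun (p : nat) (q : 'rV[R]_n -> R) : Prop :=
  exists c : {ffun 'I_n -> 'I_p.+1} -> R,
    q = fun x => \sum_(e : {ffun 'I_n -> 'I_p.+1} | (\sum_i e i <= p)%N)
                   c e * \prod_i x 0 i ^+ e i.

End sobolev.

(* A simplex is given by its set of vertices: n.+1 of them for a cell,
   n for a facet. *)
Record mesh (R : realType) (n : nat) := Mesh {
  mesh_size : nat ;
  vert : 'I_mesh_size -> 'rV[R]_n ;
  cells : {set {set 'I_mesh_size}}
}.

Section mesh_geometry.
Context (R : realType) (n : nat) (M : mesh R n).
Local Notation I := 'I_(mesh_size M).
Implicit Types (S T F : {set I}) (Omega : set 'rV[R]_n).

Definition hull S : set 'rV[R]_n :=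
  [set x | exists c : I -> R,
     [/\ forall i, 0 <= c i, forall i, i \notin S -> c i = 0,
         \sum_i c i = 1 & x = \sum_i c i *: vert i]].

Definition affinely_independent S : Prop :=
  forall c : I -> R, (forall i, i \notin S -> c i = 0) ->
    \sum_i c i = 0 -> \sum_i c i *: vert i = 0 -> forall i, c i = 0.

Definition simplicial_partition Omega : Prop :=
  [/\ forall T, T \in cells M -> #|T| = n.+1 /\ affinely_independent T,
      closure Omega = \bigcup_(T in [set` cells M]) hull T &
      forall T1 T2, T1 \in cells M -> T2 \in cells M ->
        hull T1 `&` hull T2 = hull (T1 :&: T2)].

Definition inball_diam (A : set 'rV[R]_n) : R :=
  sup [set d | 0 <= d /\
         exists x, [set y | 2 * enorm (y - x) <= d] `<=` A].

Definition shape_regular (sigma : R) : Prop :=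
  forall T, T \in cells M -> diam (hull T) <= sigma * inball_diam (hull T).

Definition cells_at F : {set {set I}} := [set T in cells M | F \subset T]%SET.

Definition int_facets : {set {set I}} :=
  [set F : {set I} | (#|F| == n) && (#|cells_at F| == 2%N)]%SET.
Definition bdry_facets : {set {set I}} :=
  [set F : {set I} | (#|F| == n) && (#|cells_at F| == 1%N)]%SET.

(* Integral over a facet for the (n-1)-dimensional surface measure, through the
   affine parametrization by the reference simplex of R^(n-1). *)
Definition facet_verts F : seq 'rV[R]_n := [seq vert i | i <- enum F].
Definition facet_edges F : 'M[R]_(n.-1, n) :=
  \matrix_(i < n.-1, j < n) (nth 0 (facet_verts F) i.+1 - nth 0 (facet_verts F) 0%N) 0 j.
Definition facet_param F (s : 'rV[R]_n.-1) : 'rV[R]_n :=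
  nth 0 (facet_verts F) 0%N + s *m facet_edges F.
Definition ref_simplex (k : nat) : set 'rV[R]_k :=
  [set s | (forall i, 0 <= s 0 i) /\ \sum_i s 0 i <= 1].
Arguments ref_simplex : clear implicits.

Definition facet_L2 F (t : 'rV[R]_n -> R) : Prop :=
  L2 (ref_simplex n.-1) (t \o facet_param F).

Definition facet_int F (t : 'rV[R]_n -> R) : R :=
  Num.sqrt (\det (facet_edges F *m (facet_edges F)^T)) *
  \int[leb R n.-1]_(s in ref_simplex n.-1) t (facet_param F s).

Definition cell T : set 'rV[R]_n := (hull T)°.

(* t represents the L^2(F)-trace of v|_T: the trace operator is the continuous
   extension to H^1(T) of the restriction of smooth functions to F. *)
Definition is_trace T F (v t : 'rV[R]_n -> R) : Prop :=
  facet_L2 F t /\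
  exists z : nat -> 'rV[R]_n -> R,
    [/\ forall j, smooth (z j),
        (fun j => H1dist_sqr (cell T) (z j) v) @ \oo --> (0 : R) &
        (fun j => facet_int F (fun x => (z j x - t x) ^+ 2)) @ \oo --> (0 : R)].

Definition is_jump F (v t : 'rV[R]_n -> R) : Prop :=
  if F \in int_facets then
    exists T1 T2 (t1 t2 : 'rV[R]_n -> R),
      [/\ cells_at F = [set T1; T2]%SET, is_trace T1 F v t1, is_trace T2 F v t2 &
          t = t1 \- t2]
  else exists2 T, cells_at F = [set T]%SET & is_trace T F v t.

(* For v in the broken H^1-space, [v] exists, and all its representatives
   (including a change of sign on interior facets) have the same L^2(F)-norm,
   so that the infimum below is over a singleton. *)
Definition jump_sqr F (v : 'rV[R]_n -> R) : \bar R :=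
  ereal_inf [set (facet_int F (fun x => t x ^+ 2))%:E | t in is_jump F v].

Definition brokenH1 Omega (v : 'rV[R]_n -> R) : Prop :=
  L2 Omega v /\ forall T, T \in cells M -> H1 (cell T) v.

Definition dgnorm (v : 'rV[R]_n -> R) : \bar R :=
  sqrte (\sum_(T in cells M) (adir (cell T) v v)%:E +
         \sum_(F in int_facets :|: bdry_facets)
            ((diam (hull F))^-1)%:E * jump_sqr F v)%E.

Definition brokenP Omega (p : nat) (v : 'rV[R]_n -> R) : Prop :=
  measurable_fun Omega v /\
  forall T, T \in cells M ->
    exists2 q, poly_fun p q & ae_on (hull T) (fun x => v x = q x).

End mesh_geometry.

Section legendre.
Context (R : realType) (n : nat).
Implicit Types (Rf : 'rV[R]_n -> R -> \bar R) (w v phi : 'rV[R]_n -> R).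

(* Legendre functions of one variable with essential domain [b, +oo[ *)
Record legendre (b : R) (r : R -> \bar R) : Prop := {
  legendre_gtNy : forall y, r y != -oo%E ;
  legendre_dom : forall y, (r y < +oo)%E <-> b <= y ;
  legendre_strict_convex : forall y1 y2 t : R, b <= y1 -> b <= y2 -> y1 != y2 ->
    0 < t -> t < 1 ->
    (r (t * y1 + (1 - t) * y2)%R < t%:E * r y1 + (1 - t)%:E * r y2)%E ;
  legendre_derivable : forall y, b < y -> derivable (fine \o r) y 1 ;
  legendre_singular : `|derive1 (fine \o r) y| @[y --> b^'+] --> +oo
}.

Definition supercoercive (r : R -> \bar R) : Prop :=
  forall C : R, exists N : R, forall y : R,
    N <= `|y| -> ((C * `|y|)%:E <= r y)%E.

(* Continuity in y is understood on the essential domain. *)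
Record legendre_integrand (Omega : set 'rV[R]_n) phi Rf : Prop := {
  integrand_measurable : forall y, measurable_fun Omega (Rf^~ y) ;
  integrand_continuous : ae_on Omega (fun x =>
    {within [set y | phi x <= y], continuous (fine \o Rf x)}) ;
  integrand_legendre : ae_on Omega (fun x => legendre (phi x) (Rf x)) ;
  integrand_supercoercive : ae_on Omega (fun x => supercoercive (Rf x))
}.

Definition conjugate Rf (x : 'rV[R]_n) (z : R) : \bar R :=
  ereal_sup [set ((z * y)%:E - Rf x y)%E | y in [set: R]].

Definition dR Rf w : 'rV[R]_n -> R := fun x => derive1 (fine \o Rf x) (w x).
Definition dRs Rf (psi : 'rV[R]_n -> R) : 'rV[R]_n -> R :=
  fun x => derive1 (fine \o conjugate Rf x) (psi x).

Record conjugate_facts (Omega : set 'rV[R]_n) phi Rf : Prop := {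
  conj_fin : ae_on Omega (fun x => forall z, conjugate Rf x z \is a fin_num) ;
  conj_C1 : ae_on Omega (fun x =>
    (forall z, derivable (fine \o conjugate Rf x) z 1) /\
    continuous (derive1 (fine \o conjugate Rf x))) ;
  conj_strict_convex : ae_on Omega (fun x =>
    forall z1 z2 t : R, z1 != z2 -> 0 < t -> t < 1 ->
    (conjugate Rf x (t * z1 + (1 - t) * z2)%R <
       t%:E * conjugate Rf x z1 + (1 - t)%:E * conjugate Rf x z2)%E) ;
  conj_inverse : ae_on Omega (fun x => forall y z : R, phi x < y ->
    (derive1 (fine \o Rf x) y = z <-> derive1 (fine \o conjugate Rf x) z = y)) ;
  conj_map : forall psi, Linfty Omega psi ->
    L2 Omega (dRs Rf psi) /\ ae_on Omega (fun x => phi x < dRs Rf psi x) ;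
  (* from L^oo(Omega) to L^2(Omega) *)
  conj_continuous : forall psi, Linfty Omega psi -> forall eps : R, 0 < eps ->
    exists2 delta : R, 0 < delta & forall psi', Linfty Omega psi' ->
      ae_on Omega (fun x => `|psi' x - psi x| <= delta) ->
      ip Omega (dRs Rf psi' \- dRs Rf psi) (dRs Rf psi' \- dRs Rf psi) <= eps ;
  conj_strict_mono : forall psi psi', Linfty Omega psi -> Linfty Omega psi' ->
    ~ ae_on Omega (fun x => psi x = psi' x) ->
    0 < ip Omega (dRs Rf psi \- dRs Rf psi') (psi \- psi')
}.

Definition bregman Rf w v : 'rV[R]_n -> \bar R := fun x =>
  (Rf x (w x) - Rf x (v x) - (dR Rf v x * (w x - v x))%:E)%E.

(* (D(w,v),1), possibly +oo *)
Definition bregman_int (Omega : set 'rV[R]_n) Rf w v : \bar R :=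
  (\int[leb R n]_(x in Omega) bregman Rf w v x)%E.

End legendre.

Section obstacle.
Context (R : realType) (n : nat) (Omega : set 'rV[R]_n).
Implicit Types (f phi u v : 'rV[R]_n -> R).

Definition Kset phi : set ('rV[R]_n -> R) :=
  [set v | H10 Omega v /\ ae_on Omega (fun x => phi x <= v x)].

Definition obstacle_solution f phi u : Prop :=
  Kset phi u /\
  forall v, Kset phi v -> ip Omega f (v \- u) <= adir Omega u (v \- u).

End obstacle.

Section abstract_space.
Context (R : realType) (V : normedModType R).

Definition finite_dim : Prop :=
  exists (d : nat) (b : 'I_d -> V), forall v : V,
    exists c : 'I_d -> R, v = \sum_i c i *: b i.

Definition symmetric_bilinear (a : V -> V -> R) : Prop :=
  (forall v w, a v w = a w v) /\
  forall (c : R) v w z, a (c *: v + w) z = c * a v z + a w z.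

Definition dual_norm (l : V -> R) : \bar R :=
  ereal_sup [set `|l v|%:E | v in [set v : V | `|v| <= 1]].

End abstract_space.

(* Main.v *)
Require Import Defs.
From HB Require Import structures.
From mathcomp Require Import all_boot all_order all_algebra.
From mathcomp Require Import all_classical all_reals all_analysis measurable_realfun.
From mathcomp Require Import ring lra.
Set Implicit Arguments.
Unset Strict Implicit.
Unset Printing Implicit Defensive.
Import Order.TTheory GRing.Theory Num.Theory.
Import numFieldNormedType.Exports.
Local Open Scope classical_set_scope.
Local Open Scope ring_scope.

(* Testing the k-th equation against u_h^k - Pi_h u turns the duality term into
   (psi^k - psi^(k-1), u - o^k), because Pi_h u and u, respectively p(u_h^k) and
   o^k, have the same moments against W_h; the three-point identity for the
   Bregman divergence bounds it by D(u, o^(k-1)) - D(u, o^k). The discrete energy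
   a_h(v, v)/2 - (f, p v) is nonincreasing along the iterates, so summing over k
   gives
     D_m / A + |e|_a^2 / 2 + a_h(Pi_h u, e) - (f, p e) <= D_0 / A
   for e := u_h^m - Pi_h u. The consistency part splits into delta_h(u) applied
   to e, absorbed by coercivity, and into e_K and e_h through the variational
   inequality. What remains is ||p(u_h^m) - u||^2 <= 2 ||p e||^2 + 2 ||u - J_h u||^2
   in the DG-seminorm, for which weak gradients have to be unique (tested against
   bumps built from exp(-1/t)) and polynomials must have their classical gradient
   as weak gradient. *)

(** * Lower integrals *)

(** The constants come from one balance, with C := [Ccoerc]. The energy leaves C/2 |e|^2. Young's
    inequality, |delta(e)| <= N |e| <= N^2/C + (C/4) |e|^2, spends half of it. By the bound on p,
    what is left dominates C/(4 Cp^2) times the squared DG-norm of p e, and the final splitting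
    halves this to C/(8 Cp^2), while moving C/(4 Cp^2) ||u - J_h u||^2 to the right. Two obstacles
    shape the rest. Functions are mere representatives: gradients come from a choice operator,
    traces from approximating sequences, and p and C_h are linear only almost everywhere, so each
    identity has to be transported along null sets; for jumps, near-minimizers of an infimum stand
    in for uniqueness of the trace. Moreover, Bregman integrals, the dual norm and the DG-norm are
    extended reals that may be infinite a priori. The telescoping is therefore an induction on
    inequalities without subtraction, and infinite values are discarded only in the final
    arithmetic. *)

Section ae_integral.
Context d (T : measurableType d) (R : realType) (mu : {measure set T -> \bar R}).
Implicit Types (D : set T) (F G : T -> \bar R).
Local Open Scope ereal_scope.
Import HBNNSimple.

(** A simple function below [F], cut to zero on a measurable null set containing the exceptional
    points, lies below [G] and keeps its integral. The comparison thus takes place between the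
    suprema over simple functions that define both sides. *)
Lemma ge0_ae_le_integral D F G :
  (forall x, D x -> 0 <= F x) -> (forall x, D x -> 0 <= G x) ->
  {ae mu, forall x, D x -> F x <= G x} ->
  \int[mu]_(x in D) F x <= \int[mu]_(x in D) G x.
Proof.
move=> F0 G0 [N [mN N0 sN]]; rewrite !ge0_integralE//.
apply: ge_ereal_sup => _ [h /= hF <-].
have mNC : measurable (~` N) by exact: measurableC.
apply: le_ereal_sup_tmp; exists (sintegral mu (proj_nnsfun h mNC)).
  exists (proj_nnsfun h mNC) => //= x; rewrite mindicE.
  case: (boolP (x \in ~` N)) => [|_]; last first.
    by rewrite mulr0 patchE; case: ifPn => // /set_mem /G0.
  rewrite mulr1 inE => /= xN; apply: (le_trans (hF x)).
  rewrite !patchE; case: ifPn => // /set_mem Dx.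
  by apply: contrapT => FG; apply/xN/sN => /= /(_ Dx).
rewrite -!integralT_nnsfun (@ge0_negligible_integral _ _ _ _ _ N)//; last 2 first.
- exact/measurable_EFinP.
- by move=> x _; rewrite lee_fin.
rewrite setTD integral_mkcond; rewrite le_eqVlt; apply/orP; left; apply/eqP.
apply: eq_integral => x _; rewrite patchE /= mindicE.
by case: ifPn => _; rewrite ?mulr1 ?mulr0.
Qed.

Lemma ae_eq_lower_integral D F G :
  {ae mu, forall x, D x -> F x = G x} ->
  \int[mu]_(x in D) F x = \int[mu]_(x in D) G x.
Proof.
move=> FG; rewrite integralE [RHS]integralE.
suff H : forall F' G' : T -> \bar R, (forall x, 0 <= F' x) -> (forall x, 0 <= G' x) ->
    {ae mu, forall x, D x -> F' x = G' x} ->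
    \int[mu]_(x in D) F' x = \int[mu]_(x in D) G' x.
  by congr (_ - _); apply: H => //; apply: filterS FG => x FG Dx;
    rewrite ?funeposE ?funenegE FG.
move=> F' G' F0 G0 e; apply/eqP; rewrite eq_le; apply/andP; split;
  by apply: ge0_ae_le_integral => //; apply: filterS e => x /[apply] ->.
Qed.

(* No measurability is asked of F and G, whose integrals are lower integrals:
   this dispenses with the measurability of the superpositions x |-> R(x, o x). *)
Lemma ae_le_integralD D F G (g : T -> R) : measurable D ->
  mu.-integrable D (EFin \o g) ->
  {ae mu, forall x, D x -> [/\ 0 <= F x, 0 <= G x & F x + (g x)%:E <= G x]} ->
  \int[mu]_(x in D) F x + \int[mu]_(x in D) (g x)%:E <= \int[mu]_(x in D) G x.
Proof.
move=> mD ig H.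
(* Passing to positive parts turns signs known almost everywhere into signs that hold everywhere. *)
have -> : \int[mu]_(x in D) F x = \int[mu]_(x in D) F^\+ x.
  by apply: ae_eq_lower_integral; apply: filterS H => x /[apply] -[F0 _ _];
    rewrite funeposE; apply/esym/max_idPl.
have -> : \int[mu]_(x in D) G x = \int[mu]_(x in D) G^\+ x.
  by apply: ae_eq_lower_integral; apply: filterS H => x /[apply] -[_ G0 _];
    rewrite funeposE; apply/esym/max_idPl.
have {H} : {ae mu, forall x, D x -> F^\+ x + (g x)%:E <= G^\+ x}.
  apply: filterS H => x /[apply] -[F0 G0]; rewrite !funeposE.
  by rewrite (max_idPl F0) (max_idPl G0).
have : forall x, 0 <= F^\+ x by [].
have : forall x, 0 <= G^\+ x by [].
move: (F^\+) (G^\+) => {}F {}G G0 F0 H.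
have mg : measurable_fun D g by exact/measurable_EFinP/measurable_int/ig.
rewrite [X in X + _]ge0_integralE//.
have igfin : \int[mu]_(x in D) (g x)%:E \is a fin_num.
  exact: integrable_fin_num.
rewrite -leeBrDr//.
apply: ge_ereal_sup => _ [h /= hF <-].
rewrite leeBrDr//.
(* For a simple [h] below [F], the function [k] is measurable and almost everywhere below [G] on
   [D], and it dominates [h + g]: it mediates between the two lower integrals. *)
pose k x := Order.max (h x + g x)%R 0%R.
have mh : measurable_fun D h by exact: measurable_funTS.
have mk : measurable_fun D k by apply: measurable_maxr => //; apply: measurable_funD.
have hk : \int[mu]_(x in D) (k x)%:E <= \int[mu]_(x in D) G x.
  apply: ge0_ae_le_integral => //.
    by move=> x _; rewrite lee_fin le_max lexx orbT.
  apply: filterS H => x /[apply] H; rewrite /k.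
  rewrite EFin_max ge_max G0 andbT; apply: le_trans H.
  rewrite EFinD leeD2r//; apply: (le_trans (hF x)).
  by rewrite patchE; case: ifPn => //.
apply: le_trans hk.
rewrite -integralT_nnsfun.
(* [h] lies below the extension of [F] by zero, so it vanishes off [D]. *)
have -> : \int[mu]_x (h x)%:E = \int[mu]_(x in D) (h x)%:E.
  rewrite [RHS]integral_mkcond; apply: eq_integral => x _.
  rewrite patchE; case: ifPn => // xD; apply/eqP; rewrite eq_le andbC lee_fin; apply/andP; split; first exact: fun_ge0.
  by have := hF x; rewrite patchE (negbTE xD).
rewrite (integralE _ _ (EFin \o g)).
have ifin (s : T -> \bar R) : s = (EFin \o g)^\+ \/ s = (EFin \o g)^\- ->
  \int[mu]_(x in D) s x \is a fin_num.
  case=> ->; apply: integrable_fin_num => //.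
    exact: integrable_funepos.
  exact: integrable_funeneg.
have p1 := ifin _ (or_introl erefl).
have p2 := ifin _ (or_intror erefl).
(* The negative part of [g] changes sides, so that only integrals of nonnegative measurable
   functions are added; pointwise, [h] plus the positive part of [g] is at most [k] plus its
   negative part. *)
rewrite addeA leeBlDr// -!ge0_integralD//=.
- apply: ge0_le_integral => //=.
  + by move=> x Dx; rewrite adde_ge0// lee_fin.
  + apply: emeasurable_funD; first exact/measurable_EFinP.
    by apply: measurable_funepos; exact/measurable_EFinP.
  + apply: emeasurable_funD; first exact/measurable_EFinP.
    by apply: measurable_funeneg; exact/measurable_EFinP.
  + move=> x Dx; rewrite !funeposE !funenegE /= /k -?EFinN -!EFin_max -!EFinD lee_fin.
    have h0 : (0 <= h x)%R by [].
    by rewrite /Order.max; do ! case: ifP; move=> *; lra.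
- by move=> x _; rewrite lee_fin /k le_max lexx orbT.
- exact/measurable_EFinP.
- by apply: measurable_funeneg; exact/measurable_EFinP.
- by move=> x _; rewrite lee_fin.
- exact/measurable_EFinP.
- by apply: measurable_funepos; exact/measurable_EFinP.
Qed.

End ae_integral.

(** * Boxes and Borel sets of R^n *)

Section boxes.
Context (R : realType) (n : nat).
Implicit Types (a b x : 'rV[R]_n) (U D : set 'rV[R]_n).

Definition box a b : set 'rV[R]_n := [set x | forall i, a 0 i < x 0 i < b 0 i].
Definition cbox a b : set 'rV[R]_n := [set x | forall i, a 0 i <= x 0 i <= b 0 i].

Lemma box_cbox a b : box a b `<=` cbox a b.
Proof. by move=> x ab i; have /andP[/ltW-> /ltW->] := ab i. Qed.

Lemma measurable_coordwise (P : 'I_n -> set R) : (forall i, measurable (P i)) ->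
  measurable [set x : 'rV[R]_n | forall i, P i (x 0 i)].
Proof.
move=> mP; rewrite (_ : [set x | _] =
    \bigcap_(i in [set: 'I_n]) ((fun x : 'rV[R]_n => x 0 i) @^-1` P i)).
  apply: fin_bigcap_measurable => [|i _]; first exact: finite_finset.
  rewrite -[X in measurable X]setTI.
  exact: measurable_coord.
by apply/seteqP; split => x /= H i => [_|]; exact: H.
Qed.

Lemma measurable_box a b : measurable (box a b).
Proof.
rewrite (_ : box a b = [set x | forall i, `]a 0 i, b 0 i[%classic (x 0 i)]).
  by apply: (@measurable_coordwise (fun i => `]a 0 i, b 0 i[%classic)) => i; exact: measurable_itv.
by apply/seteqP; split => x H i; have := H i; rewrite /= in_itv.
Qed.

Lemma measurable_cbox a b : measurable (cbox a b).
Proof.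
rewrite (_ : cbox a b = [set x | forall i, `[a 0 i, b 0 i]%classic (x 0 i)]).
  by apply: (@measurable_coordwise (fun i => `[a 0 i, b 0 i]%classic)) => i; exact: measurable_itv.
by apply/seteqP; split => x H i; have := H i; rewrite /= in_itv.
Qed.

Lemma closed_cbox a b : closed (cbox a b).
Proof.
rewrite (_ : cbox a b = \bigcap_(i in [set: 'I_n])
    ((fun x : 'rV[R]_n => x 0 i) @^-1` `[a 0 i, b 0 i]%classic)).
  apply: closed_bigI => i _; apply: preimage_closed.
    by move=> x _; exact: coord_continuous.
  exact: interval_closed.
apply/seteqP; split => x /= H i => [_|]; first by rewrite /= in_itv; exact: H.
by have := H i I; rewrite /= in_itv.
Qed.

Lemma coord_le_norm x i : `|x 0 i| <= `|x|.
Proof.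
have -> : `|x| = mx_norm x by []; rewrite mx_normrE.
exact: (le_bigmax (0 : R) (fun ij : 'I_1 * 'I_n => `|x ij.1 ij.2|) (0, i)).
Qed.

Lemma norm_lt_coord x (e : R) : 0 < e -> (forall i, `|x 0 i| < e) -> `|x| < e.
Proof.
move=> e0 xe; have -> : `|x| = mx_norm x by [].
rewrite mx_normrE; apply: bigmax_lt => //= -[i j] _.
by rewrite ord1.
Qed.

Lemma norm_le_coord x (e : R) : 0 <= e -> (forall i, `|x 0 i| <= e) -> `|x| <= e.
Proof.
move=> e0 xe; have -> : `|x| = mx_norm x by [].
rewrite mx_normrE; apply: bigmax_le => //= -[i j] _.
by rewrite ord1.
Qed.

Lemma bounded_cbox a b : bounded_set (cbox a b).
Proof.
exists (`|a| + `|b|); split; first exact: num_real.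
move=> M abM x abx /=; apply/ltW/norm_lt_coord.
  by apply: le_lt_trans abM; rewrite addr_ge0.
move=> i; apply: le_lt_trans abM.
have /andP[ax xb] := abx i.
have := coord_le_norm a i; have := coord_le_norm b i.
rewrite !ler_norml => /andP[b1 b2] /andP[a1 a2].
have := normr_ge0 a; have := normr_ge0 b.
by move=> *; apply/andP; split; lra.
Qed.

Lemma compact_cbox a b : compact (cbox a b).
Proof.
by apply: bounded_closed_compact; [exact: bounded_cbox|exact: closed_cbox].
Qed.

(** Rational corners make the family countable. This gives Borel measurability of open sets for the
    product sigma-algebra, and later allows almost-everywhere statements to be proved box by box. *)
Definition rbox (ab : 'rV[rat]_n * 'rV[rat]_n) : set 'rV[R]_n :=
  box (map_mx ratr ab.1) (map_mx ratr ab.2).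

Lemma open_rboxP U x : open U -> U x -> exists ab : 'rV[rat]_n * 'rV[rat]_n,
  rbox ab x /\ cbox (map_mx ratr ab.1) (map_mx ratr ab.2) `<=` U.
Proof.
move=> oU Ux; have /nbhs_ballP[e /= e0 eU] : nbhs x U by exact: open_nbhs_nbhs.
have ex1 i : exists q : rat, x 0 i - e < ratr q < x 0 i.
  have [|q] := @rat_in_itvoo R (x 0 i - e) (x 0 i); first by rewrite ltrBlDr ltrDl.
  by rewrite in_itv; exists q.
have ex2 i : exists q : rat, x 0 i < ratr q < x 0 i + e.
  have [|q] := @rat_in_itvoo R (x 0 i) (x 0 i + e); first by rewrite ltrDl.
  by rewrite in_itv; exists q.
exists (\row_i xchoose (ex1 i), \row_i xchoose (ex2 i)).
split=> [i|y H].
  by rewrite /= !mxE; have /andP[_ ->] := xchooseP (ex1 i);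
    have /andP[-> _] := xchooseP (ex2 i).
apply: eU; split => // i j; rewrite ord1 /= /ball /=.
have := H j; rewrite /= !mxE.
have /andP[a1 a2] := xchooseP (ex1 j); have /andP[b1 b2] := xchooseP (ex2 j).
by move=> /andP[c1 c2]; rewrite ltr_norml; apply/andP; split; lra.
Qed.

Lemma open_bigcup_rbox U : open U -> U = \bigcup_(ab in
  [set ab | cbox (map_mx ratr ab.1) (map_mx ratr ab.2) `<=` U]) rbox ab.
Proof.
move=> oU; apply/seteqP; split => [x /(open_rboxP oU)[ab [? ?]]|x [ab /= abU]].
  by exists ab.
by move=> /box_cbox /abU.
Qed.

Lemma open_measurable_rV U : open U -> measurable U.
Proof.
move=> /open_bigcup_rbox ->.
rewrite bigcup_mkcond; apply: countable_bigcupT_measurable => // ab.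
by case: ifPn => // _; exact: measurable_box.
Qed.

Lemma continuous_measurable_rV (f : 'rV[R]_n -> R) :
  continuous f -> measurable_fun [set: 'rV[R]_n] f.
Proof.
move=> /continuousP cf; apply: (measurability _ (RGenOpens.measurableE R)).
move=> _ [_ [a [b ->] <-]]; rewrite setTI.
have oab : open (`]a, b[%classic : set R) by exact: interval_open.
apply: open_measurable_rV.
by apply: (cf _ oab).
Qed.

Lemma continuous_bounded_rV (f : 'rV[R]_n -> R) D : continuous f ->
  bounded_set D -> exists C, forall x, D x -> `|f x| <= C.
Proof.
move=> cf [M [_ DM]]; pose c : 'rV[R]_n := const_mx (M + 1).
have cK := @compact_cbox (- c) c.
have : compact (f @` cbox (- c) c).
  by apply: continuous_compact => //; exact: continuous_subspaceT.
move=> /compact_bounded[C [_ HC]]; exists (C + 1) => x /(DM (M + 1)) /= xM.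
apply: (HC (C + 1)); rewrite ?ltrDl//; exists x => // i; rewrite !mxE -ler_norml.
by apply: le_trans (coord_le_norm _ _) _; apply: xM; rewrite ltrDl.
Qed.

End boxes.

Lemma lebS (R : realType) (n : nat) (A : set 'rV[R]_n.+1) :
  leb R n.+1 A = (lebesgue_measure \x leb R n)%E (@rV_cons R n @^-1` A).
Proof. by []. Qed.

Lemma leb_cbox_lty (R : realType) (n : nat) (a b : 'rV[R]_n) :
  (leb R n (cbox a b) < +oo)%E.
Proof.
elim: n a b => [|n IH] a b.
  by rewrite /= diracE; case: (_ \in _); rewrite ltry.
rewrite lebS (_ : _ @^-1` _ = `[a 0 ord0, b 0 ord0]%classic `*`
    cbox (\row_j a 0 (lift ord0 j)) (\row_j b 0 (lift ord0 j))); last first.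
  apply/seteqP; split => -[t x] /=.
    move=> H; split => /=.
      by have := H ord0; rewrite /rV_cons mxE unlift_none in_itv.
    by move=> j; have := H (lift ord0 j); rewrite /rV_cons !mxE liftK.
  move=> [H1 H2] i; rewrite /rV_cons mxE; case: (unliftP ord0 i) => [j|] ->.
    by have := H2 j; rewrite !mxE.
  by move: H1; rewrite /= in_itv.
rewrite product_measure1E//=; last exact: measurable_cbox.
have IHab := IH (\row_j a 0 (lift ord0 j)) (\row_j b 0 (lift ord0 j)).
apply: lte_mul_pinfty => //.
by rewrite lebesgue_measure_itv/=; case: ifP.
Qed.

Lemma leb_bounded_lty (R : realType) (n : nat) (D : set 'rV[R]_n) :
  measurable D -> bounded_set D -> (leb R n D < +oo)%E.
Proof.
move=> mD [M [_ DM]]; pose c : 'rV[R]_n := const_mx (M + 1).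
apply: le_lt_trans (leb_cbox_lty (- c) c).
apply: le_measure; rewrite ?inE//; first exact: measurable_cbox.
move=> x /(DM (M + 1)) /= xM i; rewrite !mxE -ler_norml.
by apply: le_trans (coord_le_norm _ _) _; apply: xM; rewrite ltrDl.
Qed.

(** * Smooth functions *)

Section smooth_algebra.
Context (R : realType) (n : nat).
Implicit Types (f g : 'rV[R]_n -> R) (x : 'rV[R]_n).

Lemma Ck_continuous k f : Ck k f -> continuous f.
Proof. by case: k => [|k] []. Qed.

Lemma CkW k f : Ck k.+1 f -> Ck k f.
Proof.
elim: k f => [|k IH] f; first by case.
move=> -[cf Hf]; split => // i; have [df /IH Hi] := Hf i; by split.
Qed.

Lemma pderivD f g i : (forall x, derivable f x (delta_mx 0 i)) ->
  (forall x, derivable g x (delta_mx 0 i)) ->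
  pderiv i (f \+ g) = pderiv i f \+ pderiv i g.
Proof. by move=> df dg; apply/funext => x; exact: deriveD. Qed.

Lemma pderivM f g i : (forall x, derivable f x (delta_mx 0 i)) ->
  (forall x, derivable g x (delta_mx 0 i)) ->
  pderiv i (f \* g) = (f \* pderiv i g) \+ (g \* pderiv i f).
Proof. by move=> df dg; apply/funext => x; exact: deriveM. Qed.

Lemma pderiv_cst c i : pderiv i (cst c : 'rV[R]_n -> R) = cst 0.
Proof. by apply/funext => x; exact: derive_cst. Qed.

Lemma Ck_cst k c : Ck k (cst c : 'rV[R]_n -> R).
Proof.
elim: k c => [|k IH] c /=; first by split => // x; exact: cst_continuous.
split=> [x|i]; first exact: cst_continuous.
by split=> [x|]; [exact: derivable_cst|rewrite pderiv_cst].
Qed.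

Lemma CkD k f g : Ck k f -> Ck k g -> Ck k (f \+ g).
Proof.
elim: k f g => [|k IH] f g /= [cf Hf] [cg Hg].
  by split => // x; apply: continuousD; [exact: cf|exact: cg].
split=> [x|i]; first by apply: continuousD; [exact: cf|exact: cg].
have [df Cf] := Hf i; have [dg Cg] := Hg i.
split=> [x|]; first exact: derivableD.
by rewrite pderivD//; exact: IH.
Qed.

Lemma CkM k f g : Ck k f -> Ck k g -> Ck k (f \* g).
Proof.
elim: k f g => [|k IH] f g.
  move=> /= [cf Hf] [cg Hg].
  by split => // x; apply: continuousM; [exact: cf|exact: cg].
move=> Hf0 Hg0; have Wf := CkW Hf0; have Wg := CkW Hg0.
move: Hf0 Hg0 => /= [cf Hf] [cg Hg].
split=> [x|i]; first by apply: continuousM; [exact: cf|exact: cg].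
have [df Cf] := Hf i; have [dg Cg] := Hg i.
split=> [x|]; first exact: derivableM.
by rewrite pderivM//; apply: CkD; exact: IH.
Qed.

Lemma smooth_cst c : smooth (cst c : 'rV[R]_n -> R).
Proof. by move=> k; exact: Ck_cst. Qed.

Lemma smoothD f g : smooth f -> smooth g -> smooth (f \+ g).
Proof. by move=> sf sg k; exact: CkD. Qed.

Lemma smoothM f g : smooth f -> smooth g -> smooth (f \* g).
Proof. by move=> sf sg k; exact: CkM. Qed.

Lemma smoothB f g : smooth f -> smooth g -> smooth (f \- g).
Proof.
move=> sf sg; rewrite (_ : f \- g = f \+ (cst (-1) \* g)).
  by apply: smoothD => //; apply: smoothM => //; exact: smooth_cst.
by apply/funext => x /=; rewrite mulN1r.
Qed.

Lemma smooth_continuous f : smooth f -> continuous f.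
Proof. by move=> /(_ 0%N)/Ck_continuous. Qed.

Lemma smooth_derivable f i x : smooth f -> derivable f x (delta_mx 0 i).
Proof. by move=> /(_ 1%N)[_ /(_ i)[]]. Qed.

Lemma smooth_pderiv f i : smooth f -> smooth (pderiv i f).
Proof. by move=> sf k; have [_ /(_ i)[]] := sf k.+1. Qed.

Lemma smooth_sum (I : Type) (r : seq I) (P : pred I) (F : I -> 'rV[R]_n -> R) :
  (forall i, P i -> smooth (F i)) -> smooth (fun x => \sum_(i <- r | P i) F i x).
Proof.
move=> sF; elim: r => [|i r IH].
  rewrite (_ : (fun x => _) = cst 0); first exact: smooth_cst.
  by apply/funext => x; rewrite big_nil.
have [Pi|Pi] := boolP (P i).
  rewrite (_ : (fun x => _) = F i \+ (fun x => \sum_(i <- r | P i) F i x)).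
    by apply: smoothD => //; exact: sF.
  by apply/funext => x; rewrite big_cons Pi.
by under eq_fun do rewrite big_cons (negbTE Pi).
Qed.

Lemma smooth_prod (I : Type) (r : seq I) (P : pred I) (F : I -> 'rV[R]_n -> R) :
  (forall i, P i -> smooth (F i)) -> smooth (fun x => \prod_(i <- r | P i) F i x).
Proof.
move=> sF; elim: r => [|i r IH].
  rewrite (_ : (fun x => _) = cst 1); first exact: smooth_cst.
  by apply/funext => x; rewrite big_nil.
have [Pi|Pi] := boolP (P i).
  rewrite (_ : (fun x => _) = F i \* (fun x => \prod_(i <- r | P i) F i x)).
    by apply: smoothM => //; exact: sF.
  by apply/funext => x; rewrite big_cons Pi.
by under eq_fun do rewrite big_cons (negbTE Pi).
Qed.

Lemma smoothX f k : smooth f -> smooth (fun x => f x ^+ k).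
Proof.
move=> sf; elim: k => [|k IH].
  by rewrite (_ : (fun x => _) = cst 1); [exact: smooth_cst|apply/funext => x; rewrite expr0].
rewrite (_ : (fun x => _) = f \* (fun x => f x ^+ k)); first exact: smoothM.
by apply/funext => x; rewrite exprS.
Qed.

Lemma is_derive_comp_coord (h : R -> R) (dh : R) (i j : 'I_n) x :
  is_derive (x 0 j) 1 h dh ->
  is_derive x (delta_mx 0 i) (fun y : 'rV[R]_n => h (y 0 j)) (if i == j then dh else 0).
Proof.
move=> [dh1 dh2]; case: eqVneq => [->|ij].
  have E : (fun s : R => s^-1 *: (((fun y : 'rV[R]_n => h (y 0 j)) \o shift x) (s *: delta_mx 0 j) - h (x 0 j))) =
     (fun s : R => s^-1 *: ((h \o shift (x 0 j)) (s *: 1) - h (x 0 j))).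
    by apply/funext => s /=; rewrite !mxE !eqxx.
  apply: DeriveDef; first by rewrite /derivable E.
  by rewrite /derive E.
have E : (fun s : R => s^-1 *: (((fun y : 'rV[R]_n => h (y 0 j)) \o shift x) (s *: delta_mx 0 i) - h (x 0 j))) =
     cst 0.
  by apply/funext => s /=; rewrite !mxE eqxx eq_sym (negbTE ij) /= mulr0 add0r subrr scaler0.
apply: DeriveDef; rewrite /derivable /derive ?E.
  exact: is_cvg_cst.
exact: lim_cst.
Qed.

(** The order-k claim for [h] needs the order-(k-1) claim for its derivative, so the induction has
    to run over a whole class [S] stable under differentiation. *)
Lemma smooth_comp_coord (S : set (R -> R)) (i : 'I_n) :
  (forall h, S h -> exists2 h', S h' & forall t : R, is_derive t 1 h (h' t)) ->
  forall h, S h -> smooth (fun x : 'rV[R]_n => h (x 0 i)).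
Proof.
move=> HS h Sh k; elim: k h Sh => [|k IH] h Sh.
  have [h' _ dh] := HS h Sh.
  split => // x; apply: (@continuous_comp _ _ _ (fun y : 'rV[R]_n => y 0 i) h).
    exact: coord_continuous.
  by apply: differentiable_continuous; apply/derivable1_diffP; case: (dh (x 0 i)).
have [h' Sh' dh] := HS h Sh.
split=> [|j].
  move=> x; apply: (@continuous_comp _ _ _ (fun y : 'rV[R]_n => y 0 i) h).
    exact: coord_continuous.
  by apply: differentiable_continuous; apply/derivable1_diffP; case: (dh (x 0 i)).
have D x := is_derive_comp_coord j (dh (x 0 i)).
split=> [x|]; first by case: (D x).
have -> : pderiv j (fun x : 'rV[R]_n => h (x 0 i)) =
   fun x => if j == i then h' (x 0 i) else 0.
  by apply/funext => x; case: (D x).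
by case: eqP => _; [exact: IH|exact: Ck_cst].
Qed.

Lemma smooth_coord (i : 'I_n) : smooth (fun x : 'rV[R]_n => x 0 i).
Proof.
(* Affine functions form such a class: the derivative is the constant slope. *)
apply: (@smooth_comp_coord [set h | exists a b, h = fun t => a * t + b] i _ id).
  move=> h [a [b ->]]; exists (cst a).
    by exists 0, a; apply/funext => t; rewrite mul0r add0r.
  move=> t; have H : is_derive t 1 ((a \*: (id : R -> R)) + cst b) (a *: 1 + 0).
    by apply: is_deriveD.
  by move: H; rewrite addr0 /GRing.scale /= mulr1.
by exists 1, 0; apply/funext => t; rewrite mul1r addr0.
Qed.

Lemma smooth_poly_fun p (q : 'rV[R]_n -> R) : poly_fun p q -> smooth q.
Proof.
move=> [c ->]; apply: smooth_sum => e _.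
apply: (@smoothM (cst (c e))); first exact: smooth_cst.
by apply: smooth_prod => i _; apply: smoothX; exact: smooth_coord.
Qed.

End smooth_algebra.

(** * Smooth bump functions on boxes *)

Section bump_functions.
Context (R : realType).
Implicit Types (p : {poly R}) (t : R).

(** All derivatives of exp(-1/t), extended by 0 to t <= 0, have this form: differentiation replaces
    [p] by X^2 (p - p'). The polynomial parameter exists to make the class stable under
    differentiation. *)
Definition flat p t : R := if 0 < t then p.[t^-1] * expR (- t^-1) else 0.

Lemma horner_le_expn p s : 1 <= s ->
  `|p.[s]| <= (\sum_(i < size p) `|p`_i|) * s ^+ size p.
Proof.
move=> s1; rewrite horner_coef; apply: le_trans (ler_norm_sum _ _ _) _.
rewrite mulr_suml; apply: ler_sum => i _.
rewrite normrM ler_wpM2l// normrX ger0_norm ?(le_trans ler01)//.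
by apply: ler_weXn2l => //; exact: ltnW.
Qed.

(** With s = 1/t and d the size of [p], the factor |p(s)| is O(s^d) for s >= 1, while exp(s) >=
    s^(d+2) / (d+2)!, which leaves s^(-2). A quadratic bound is what differentiability at 0
    requires. *)
Lemma flat_le_sqr p : exists2 C, 0 < C & forall t, t <= 1 -> `|flat p t| <= C * t ^+ 2.
Proof.
pose d := size p; pose A := \sum_(i < d) `|p`_i|.
have A0 : 0 <= A by apply: sumr_ge0.
(* The summand 1 keeps the constant positive even for [p = 0]. *)
exists ((A + 1) * (d.+2)`!%:R); first by rewrite mulr_gt0 ?ltr0n ?fact_gt0// ltr_wpDl.
move=> t t1; rewrite /flat; case: ifPn => [t0|_]; last first.
  by rewrite normr0 mulr_ge0 ?sqr_ge0// mulr_ge0 ?ler0n ?addr_ge0.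
set s := t^-1; have s1 : 1 <= s by rewrite /s invf_ge1.
have s0 : 0 < s by exact: lt_le_trans s1.
have -> : t = s^-1 by rewrite /s invrK.
have es : s ^+ d.+2 / (d.+2)`!%:R <= expR s.
  by apply: le_trans (expR_ge1Dxn d.+1 (ltW s0)); rewrite lerDr.
rewrite normrM (ger0_norm (expR_ge0 _)) expRN.
have f0 : 0 < (d.+2)`!%:R :> R by rewrite ltr0n fact_gt0.
apply: (@le_trans _ _ (A * s ^+ d / expR s)).
  by apply: ler_wpM2r; [rewrite invr_ge0 expR_ge0|exact: horner_le_expn].
have -> : A * s ^+ d / expR s = A * (s^-1 ^+ 2 * (s ^+ d.+2 / expR s)).
  rewrite exprVn (_ : s ^+ d.+2 = s ^+ 2 * s ^+ d); last by rewrite -exprD addnC addn2.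
  by field; rewrite gt_eqF ?expR_gt0// gt_eqF.
rewrite -[leRHS]mulrA [leRHS]mulrC [_ * s^-1 ^+ 2]mulrC -[leRHS]mulrA.
have e0 := expR_gt0 s.
have H : s ^+ d.+2 / expR s <= (d.+2)`!%:R.
  by rewrite ler_pdivrMr// mulrC -ler_pdivrMr.
have q0 : 0 <= s^-1 ^+ 2 by rewrite sqr_ge0.
rewrite mulrCA; apply: ler_wpM2l => //.
rewrite mulrC; apply: ler_pM => //; first by rewrite divr_ge0 ?exprn_ge0 ?expR_ge0 ?ltW.
by rewrite lerDl.
Qed.

(** Away from 0 this is the chain rule on one side and a constant on the other. At 0 the difference
    quotient is at most C |h| by [flat_le_sqr], and the claimed derivative also vanishes there. *)
Lemma is_derive_flat p t :
  is_derive t 1 (flat p) (flat ('X^2 * (p - p^`())) t).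
Proof.
have [t0|t0|<-] := ltgtP 0 t.
- rewrite {2}/flat t0.
  have tn0 : t != 0 by rewrite gt_eqF.
  apply: (@near_eq_is_derive _ _ _ (fun s : R => p.[s^-1] * expR (- s^-1))).
    near=> s; rewrite /flat ifT//; near: s; exact: lt_nbhsr.
  have dV : is_derive t 1 (fun s : R => s^-1) (- t ^- 2 *: 1).
    exact: (@is_deriveV R id t 1 1).
  have dp : is_derive t 1 (horner p \o (fun s : R => s^-1)) (p^`().[t^-1] * (- t ^- 2 *: 1)).
    by apply: is_derive1_comp => //; exact: is_derive_poly.
  have dN : is_derive t 1 (fun s : R => - s^-1) (- (- t ^- 2 *: 1)).
    exact: is_deriveN.
  have de : is_derive t 1 (expR \o (fun s : R => - s^-1)) (expR (- t^-1) * (- (- t ^- 2 *: 1))).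
    exact: is_derive1_comp.
  have := is_deriveM dp de.
  rewrite (_ : _ + _ = ('X^2 * (p - p^`())).[t^-1] * expR (- t^-1)); first by [].
  by rewrite /= !hornerE /GRing.scale /=; field.
- rewrite {2}/flat ltNge (ltW t0) /=.
  have d0 : is_derive t 1 (cst 0 : R -> R) 0 by apply: is_derive_cst.
  apply: near_eq_is_derive d0.
  near=> s; rewrite /flat ifF//; apply/negbTE; rewrite -leNgt ltW//.
  near: s; exact: lt_nbhsl.
- rewrite {2}/flat ltxx.
  have [C C0 HC] := flat_le_sqr p.
  have H : (fun h : R => h^-1 *: ((flat p \o shift 0) (h *: 1) - flat p 0)) @ 0^' --> (0 : R).
    apply/cvgr0Pnorm_le => e e0; near=> h.
    have hn0 : h != 0 by near: h; exact: nbhs_dnbhs_neq.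
    rewrite /= addr0 /GRing.scale /= mulr1 {2}/flat ltxx subr0 normrM normfV.
    rewrite ler_pdivrMl ?normr_gt0//.
    have h1 : `|h| < 1 by near: h; apply: dnbhs0_lt.
    have he : `|h| <= e / C by near: h; apply: dnbhs0_le; rewrite divr_gt0.
    apply: (le_trans (HC h _)); first by apply/ltW/(le_lt_trans (ler_norm h)).
    rewrite -normr_id -real_normK ?num_real// normr_id expr2 mulrCA; apply: ler_wpM2l => //.
    by rewrite mulrC -ler_pdivlMr.
  by apply: DeriveDef; [apply/cvg_ex; exists 0|exact: cvg_lim].
Unshelve. all: by end_near.
Qed.

(** The chain-rule factor [c] is absorbed into the polynomial, so that the derivative stays in the
    class used for smoothness. *)
Lemma is_derive_flat_affine p c s t :
  is_derive t 1 (fun t => flat p (c * t + s))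
    (flat (c *: ('X^2 * (p - p^`()))) (c * t + s)).
Proof.
have d1 : is_derive t 1 ((c \*: (id : R -> R)) + cst s) (c *: 1 + 0).
  by apply: is_deriveD.
have d2 : is_derive t 1 (fun t : R => c * t + s) c.
  by move: d1; rewrite addr0 /GRing.scale /= mulr1.
have := @is_derive1_comp _ (flat p) (fun t : R => c * t + s) t _ _ (is_derive_flat p (c * t + s)) d2.
rewrite (_ : _ * c = flat (c *: ('X^2 * (p - p^`()))) (c * t + s)) //.
by rewrite /flat; case: ifP => _; rewrite ?mul0r// hornerZ; ring.
Qed.

Lemma smooth_flat_affine n p c s (i : 'I_n) :
  smooth (fun x : 'rV[R]_n => flat p (c * x 0 i + s)).
Proof.
apply: (@smooth_comp_coord _ _ [set h | exists p, h = fun t => flat p (c * t + s)] i _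
  (fun t => flat p (c * t + s))); last by exists p.
move=> h [q ->]; eexists; last by move=> t; exact: is_derive_flat_affine.
by eexists.
Qed.

Lemma flat1_gt0 t : (0 < flat 1 t) = (0 < t).
Proof. by rewrite /flat; case: ifP; rewrite ?ltxx// hornerC mul1r expR_gt0. Qed.

Lemma flat1_ge0 t : 0 <= flat 1 t.
Proof. by rewrite /flat; case: ifP => // _; rewrite hornerC mul1r expR_ge0. Qed.

Lemma flat1_le1 t : flat 1 t <= 1.
Proof.
rewrite /flat; case: ifP => // t0; rewrite hornerC mul1r.
by rewrite -expR0 ler_expR oppr_le0 invr_ge0 ltW.
Qed.

Section box_bumps.
Context (n : nat).
Implicit Types (a b x : 'rV[R]_n).

(** The factor 1/2 keeps [1 - theta] in [1/2, 1], with value 1 exactly off the open box; its powers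
    therefore decrease to 0 inside the box and stay 1 outside. *)
Definition theta a b x : R :=
  2^-1 * \prod_i (flat 1 (x 0 i - a 0 i) * flat 1 (b 0 i - x 0 i)).

Lemma smooth_theta a b : smooth (theta a b).
Proof.
apply: (@smoothM _ _ (cst 2^-1)); first exact: smooth_cst.
apply: smooth_prod => i _; apply: smoothM.
  have := @smooth_flat_affine n 1 1 (- a 0 i) i.
  by under eq_fun do rewrite mul1r.
have := @smooth_flat_affine n 1 (-1) (b 0 i) i.
by under eq_fun do rewrite mulN1r addrC.
Qed.

Lemma theta_ge0 a b x : 0 <= theta a b x.
Proof.
by rewrite mulr_ge0// prodr_ge0// => i _; rewrite mulr_ge0// flat1_ge0.
Qed.

Lemma theta_le a b x : theta a b x <= 2^-1.
Proof.
rewrite -[leRHS]mulr1 ler_wpM2l// prodr_ile1// => i _.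
by rewrite mulr_ge0 ?flat1_ge0//= mulr_ile1 ?flat1_ge0 ?flat1_le1.
Qed.

Lemma theta_gt0 a b x : box a b x -> 0 < theta a b x.
Proof.
move=> abx; rewrite mulr_gt0// prodr_gt0// => i _.
by have /andP[? ?] := abx i; rewrite mulr_gt0// flat1_gt0 subr_gt0.
Qed.

Lemma theta_eq0 a b x : ~ box a b x -> theta a b x = 0.
Proof.
move=> /existsNP[i /negP]; rewrite negb_and -!leNgt => H.
rewrite /theta (bigD1 i)//= {1 2}/flat !subr_gt0.
by case/orP: H; rewrite leNgt => /negbTE ->; rewrite ?mul0r ?mulr0 ?mul0r ?mulr0.
Qed.

(* Smooth functions of the open box, increasing with N to its indicator. *)
Definition box_bump a b (N : nat) x : R := 1 - (1 - theta a b x) ^+ N.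

Lemma box_bump_itv a b N x : 0 <= box_bump a b N x <= 1.
Proof.
have := theta_ge0 a b x; have := theta_le a b x => t1 t0.
have h : 0 <= 1 - theta a b x by lra.
rewrite /box_bump subr_ge0 exprn_ile1//=; last by lra.
by rewrite lerBlDr lerDl exprn_ge0.
Qed.

Lemma box_bump_eq0 a b N x : ~ box a b x -> box_bump a b N x = 0.
Proof. by move=> /theta_eq0 t; rewrite /box_bump t subr0 expr1n subrr. Qed.

Lemma box_bump_cvg1 a b x : box a b x -> box_bump a b N x @[N --> \oo] --> (1 : R).
Proof.
move=> /theta_gt0 t0; rewrite -[X in _ --> X]subr0; apply: cvgB; first exact: cvg_cst.
apply: cvg_expr; have := theta_le a b x => t1.
by rewrite ger0_norm; lra.
Qed.

Lemma test_fun_box_bump (D : set 'rV[R]_n) a b N : cbox a b `<=` D ->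
  test_fun D (box_bump a b N).
Proof.
move=> abD.
have sc : closure [set x | box_bump a b N x != 0] `<=` cbox a b.
  rewrite [X in _ `<=` X](closure_id _).1; last exact: closed_cbox.
  apply: closureS => x /= H; apply: box_cbox; apply: contrapT => nb.
  by move: H; rewrite box_bump_eq0// eqxx.
split; last exact: subset_trans abD.
- apply: smoothB; first exact: smooth_cst.
  apply: smoothX; apply: smoothB; [exact: smooth_cst|exact: smooth_theta].
- by apply: (subclosed_compact _ (@compact_cbox _ _ a b)) => //; exact: closed_closure.
Qed.

End box_bumps.
End bump_functions.

(** * The fundamental lemma of the calculus of variations *)

Section boxes_generate.
Context (R : realType) (n : nat).

Definition boxes : set (set 'rV[R]_n) := [set A | exists a b, A = box a b].

Lemma boxI (a b a' b' : 'rV[R]_n) : box a b `&` box a' b' =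
  box (\row_i Num.max (a 0 i) (a' 0 i)) (\row_i Num.min (b 0 i) (b' 0 i)).
Proof.
apply/seteqP; split => x /= => [[H1 H2] i|H].
  by rewrite !mxE gt_max lt_min; have /andP[-> ->] := H1 i; have /andP[-> ->] := H2 i.
split=> i; have := H i; rewrite !mxE gt_max lt_min.
  by move=> /andP[/andP[-> _] /andP[-> _]].
by move=> /andP[/andP[_ ->] /andP[_ ->]].
Qed.

Lemma boxes_setI : setI_closed boxes.
Proof.
by move=> _ _ [a [b ->]] [a' [b' ->]]; rewrite boxI; eexists; eexists.
Qed.

(** Exhausting a slab by boxes shows that coordinates are measurable for the sigma-algebra generated
    by boxes, hence that the boxes, a class stable under intersection, generate all measurable
    sets. *)
Lemma coord_preimage_boxes (i : 'I_n) (x y : R) :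
  (fun v : 'rV[R]_n => v 0 i) @^-1` `]x, y[%classic =
  \bigcup_N box (\row_j if j == i then x else - N%:R) (\row_j if j == i then y else N%:R).
Proof.
apply/seteqP; split => v /=.
  rewrite in_itv /= => /andP[xv vy].
  have [N HN] : exists N : nat, `|v| < N%:R.
    by exists (Num.truncn `|v|).+1; exact: Num.Theory.truncnS_gt.
  exists N => // j; rewrite !mxE; case: eqP => [->|_]; first by rewrite xv vy.
  by rewrite -ltr_norml; exact: le_lt_trans (coord_le_norm _ _) HN.
by move=> [N _ /(_ i)]; rewrite !mxE eqxx in_itv.
Qed.

Lemma measurable_boxesE : @measurable _ 'rV[R]_n = <<s boxes >>.
Proof.
apply/seteqP; split; last first.
  apply: smallest_sub; first exact: sigma_algebra_measurable.
  by move=> _ [a [b ->]]; exact: measurable_box.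
have mc (i : 'I_n) : measurable_fun [set: g_sigma_algebraType boxes]
    ((fun v : 'rV[R]_n => v 0 i) : g_sigma_algebraType boxes -> R).
  apply: (measurability _ (RGenOpens.measurableE R)).
  move=> _ [_ [x [y ->] <-]]; rewrite setTI coord_preimage_boxes.
  apply: bigcup_measurable => N _; apply: sub_sigma_algebra.
  by eexists; eexists; reflexivity.
apply: smallest_sub.
  exact: smallest_sigma_algebra.
move=> A; rewrite -bigcup_seq => -[i _ [B mB <-]].
exact: mc.
Qed.

End boxes_generate.

Lemma ae_forall_countable d (T : measurableType d) (R : realType)
    (mu : {measure set T -> \bar R}) (I : countType) (P : I -> T -> Prop) :
  (forall i, {ae mu, forall x, P i x}) -> {ae mu, forall x, forall i, P i x}.
Proof.
move=> H.
have : {ae mu, forall x, forall k, if unpickle k is Some i then P i x else True}.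
  apply/ae_foralln => k; case: (unpickle k) => [i|]; first exact: H.
  by apply: aeW.
by apply: filterS => x Hx i; have := Hx (pickle i); rewrite pickleK.
Qed.

Section fundamental_lemma.
Context (R : realType) (n : nat) (D : set 'rV[R]_n) (g : 'rV[R]_n -> R).
Hypotheses (oD : open D) (mg : measurable_fun D g).
Hypothesis ig : forall a b, cbox a b `<=` D ->
  (leb R n).-integrable (cbox a b) (EFin \o g).
Hypothesis og : forall z, test_fun D z -> ip D g z = 0.

Let mD : measurable D. Proof. exact: open_measurable_rV. Qed.

Let igb a b : cbox a b `<=` D -> (leb R n).-integrable (box a b) (EFin \o g).
Proof.
move=> abD; apply: integrableS (ig abD) => //.
- exact: measurable_cbox.
- exact: measurable_box.
- exact: box_cbox.
Qed.

Let mbump a b N D' : measurable_fun D' (@box_bump R n a b N).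
Proof.
apply: measurable_funTS; apply: continuous_measurable_rV; apply: smooth_continuous.
by have [] := @test_fun_box_bump R n setT a b N (@subsetT _ _).
Qed.

Let integral_bump0 a b N : cbox a b `<=` D ->
  (\int[leb R n]_(x in box a b) (g x * box_bump a b N x)%:E = 0)%E.
Proof.
move=> abD; have := og (test_fun_box_bump N abD).
have bD : D `&` box a b = box a b.
  by apply/setIidPr; apply: subset_trans abD; exact: box_cbox.
rewrite /ip /Rintegral.
have -> : (\int[leb R n]_(x in D) (g x * box_bump a b N x)%:E =
   \int[leb R n]_(x in box a b) (g x * box_bump a b N x)%:E)%E.
  rewrite -[in RHS]bD integral_mkcondr; apply: eq_integral => x _.
  rewrite patchE; case: ifPn => // /negP; rewrite inE => nb.
  by rewrite box_bump_eq0// mulr0.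
(* [ip] is a [fine], which also sends infinite values to 0: the vanishing of [ip] gives a null
   integral only once integrability is known. *)
move=> H; rewrite -[LHS]fineK ?H//; apply: integrable_fin_num.
  exact: measurable_box.
apply: le_integrable (igb abD); first exact: measurable_box.
- apply/measurable_EFinP; apply: measurable_funM => //.
  apply: measurable_funS mg => //.
  by apply: subset_trans abD; exact: box_cbox.
- move=> x _ /=; rewrite lee_fin normrM ler_piMr//.
  by have /andP[b0 b1] := box_bump_itv a b N x; rewrite ger0_norm.
Qed.

(** The bumps tend to 1 on the open box and [g] itself dominates the products, so dominated
    convergence passes to the limit. *)
Let integral_box0 a b : cbox a b `<=` D ->
  (\int[leb R n]_(x in box a b) (g x)%:E = 0)%E.
Proof.
move=> abD; have mb := measurable_box a b.
have mgb : measurable_fun (box a b) g.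
  apply: measurable_funS mg => //.
  by apply: subset_trans abD; exact: box_cbox.
have mf N : measurable_fun (box a b) (fun x => (g x * box_bump a b N x)%:E).
  by apply/measurable_EFinP; apply: measurable_funM => //; exact: mbump.
have mgE : measurable_fun (box a b) (EFin \o g) by exact/measurable_EFinP.
have ff : {ae leb R n, forall x, box a b x ->
    (fun N => (g x * box_bump a b N x)%:E) @ \oo --> (EFin \o g) x}.
  apply: aeW => x bx; apply: cvg_EFin; first by apply: nearW.
  rewrite /= -[X in _ --> X]mulr1; apply: cvgM; first exact: cvg_cst.
  exact: box_bump_cvg1.
have iabs : (leb R n).-integrable (box a b) (fun x => `|(g x)%:E|%E).
  exact: integrable_abse (igb abD).
have fg : {ae leb R n, forall x N, box a b x ->
    (`|(g x * box_bump a b N x)%:E| <= `|(g x)%:E|)%E}.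
  apply: aeW => x N _; rewrite lee_fin normrM ler_piMr//.
  by have /andP[b0 b1] := box_bump_itv a b N x; rewrite ger0_norm.
have [_ _] := dominated_convergence mb mf mgE ff iabs fg.
rewrite (_ : [sequence _]_N = cst 0%E); last first.
  by apply/funext => N; exact: integral_bump0.
by move=> /(cvg_unique _ (cvg_cst _)) <-.
Qed.

(** Dynkin's argument: boxes form a generating pi-system, and the property passes to complements and
    disjoint unions because [g] is integrable on the fixed box. *)
Let integral_sub_box0 a b A : cbox a b `<=` D -> measurable A ->
  (\int[leb R n]_(x in A `&` box a b) (g x)%:E = 0)%E.
Proof.
move=> abD; have mb := measurable_box a b.
rewrite measurable_boxesE => sA; move: A sA.
apply: (@dynkin_induction _ 'rV[R]_n (@boxes R n)
  (fun A => \int[leb R n]_(x in A `&` box a b) (g x)%:E = 0)%E).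
- exact: measurable_boxesE.
- exact: boxes_setI.
- by rewrite setTI; exact: integral_box0.
- move=> _ [a' [b' ->]]; rewrite boxI; apply: integral_box0.
  apply: subset_trans abD => x H i; have := H i; rewrite !mxE ge_max le_min.
  by move=> /andP[/andP[_ ->] /andP[_ ->]].
- move=> S mS S0.
  have := integral_box0 abD.
  rewrite -{1}(setUIDK (box a b) S) integral_setU.
  + by rewrite [box a b `&` S]setIC S0 add0e setDE [~` S `&` _]setIC.
  + exact: measurableI.
  + exact: measurableD.
  + rewrite setUIDK; apply/measurable_EFinP; apply: measurable_funS mg => //.
    by apply: subset_trans abD; exact: box_cbox.
  + by apply/disj_set2P; rewrite setDE setIACA setICr setI0.
- move=> F mF tF F0.
  rewrite setI_bigcupl integral_bigcup.
  + by rewrite eseries0// => k _ _; exact: F0.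
  + exact: trivIset_setIr.
  + by move=> k; exact: measurableI.
  + rewrite -setI_bigcupl; apply: integrableS (igb abD) => //.
    by apply: measurableI => //; exact: bigcupT_measurable.
Qed.

(** On each rational box inside [D], [g] has null integral over every measurable part, hence
    vanishes almost everywhere; countably many such boxes cover [D]. *)
Lemma test_ortho_ae0 : ae_on D (fun x => g x = 0).
Proof.
suff : {ae leb R n, forall x, forall ab : 'rV[rat]_n * 'rV[rat]_n,
    cbox (map_mx ratr ab.1) (map_mx ratr ab.2) `<=` D ->
    @rbox R n ab x -> g x = 0}.
  apply: filterS => x H Dx; have [ab [abx abD]] := open_rboxP oD Dx.
  exact: H abD abx.
apply: ae_forall_countable => ab.
have [abD|nabD] := pselect (cbox (map_mx ratr ab.1) (map_mx ratr ab.2) `<=` D);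
  last by apply: aeW.
have mb := measurable_box (map_mx (@ratr R) ab.1) (map_mx ratr ab.2).
have := @integral_ae_eq _ _ _ (leb R n) _ mb (cst 0%E) (EFin \o g) (igb abD).
move=> /(_ (measurable_cst _)) H.
have {H}/H : forall E, E `<=` box (map_mx ratr ab.1) (map_mx ratr ab.2) ->
    measurable E -> (\int[leb R n]_(x in E) (EFin \o g) x =
      \int[leb R n]_(x in E) cst 0 x)%E.
  move=> E Eb mE; rewrite integral0 -[E](setIidl Eb).
  exact: integral_sub_box0.
by apply: filterS => x H _ /H [].
Qed.

End fundamental_lemma.

(** * Integrals of partial derivatives *)

Lemma cvg_rV (R : realType) (n : nat) (T : Type) (F : set_system T) (FF : Filter F)
    (f : T -> 'rV[R]_n) (l : 'rV[R]_n) :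
  (forall i, (fun y => f y 0 i) @ F --> l 0 i) -> f @ F --> l.
Proof.
move=> H A [P HP sPA].
have : \forall y \near F, forall i : 'I_n, P 0 i (f y 0 i).
  by apply: filter_forall => i; apply: H; exact: HP.
by apply: filterS => y Hy; apply: sPA => i j; rewrite ord1; exact: Hy.
Qed.

Lemma near_eq0_derive (R : realType) (V : normedModType R) (f : V -> R) (a v : V) :
  (\forall y \near a, f y = 0) -> 'D_v f a = 0.
Proof.
move=> f0; have e : \forall y \near a, f y = (cst 0 : V -> R) y by [].
by rewrite (near_eq_derive v e) derive_cst.
Qed.

Lemma near_norm_gt (R : realType) (V : normedModType R) (a : V) (r : R) :
  r < `|a| -> \forall y \near a, r < `|y|.
Proof.
by move=> ra; have H := cvgr_gt _ (@norm_continuous _ _ a); exact: (H _ _ ra).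
Qed.

(** The fundamental theorem of calculus on an interval beyond the support, where both endpoint
    values are 0. *)
Lemma integral_derive1_eq0 (R : realType) (k : R -> R) (r : R) :
  (forall t, derivable k t 1) -> continuous (derive1 k) ->
  (forall t, r < `|t| -> k t = 0) ->
  (\int[@lebesgue_measure R]_t (derive1 k t)%:E = 0)%E.
Proof.
move=> dk ck k0.
(* [c] exceeds [r] and is positive whatever the sign of [r], so the interval is nondegenerate. *)
pose c := `|r| + 1; have c0 : 0 < c by rewrite ltr_wpDl.
have rc : r < c by rewrite ltr_pwDr// ler_norm.
have k'0 t : ~ `[- c, c]%classic t -> derive1 k t = 0.
  rewrite /= in_itv /= -ler_norml => /negP; rewrite -ltNge => ct.
  rewrite derive1E; apply: near_eq0_derive.
  apply: filterS (@near_norm_gt R R^o _ _ ct) => s cs.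
  by apply: k0; exact: lt_trans rc cs.
have -> : (\int[@lebesgue_measure R]_t (derive1 k t)%:E =
    \int[@lebesgue_measure R]_(t in [set` `[- c, c]%R]) (derive1 k t)%:E)%E.
  rewrite [RHS]integral_mkcond; apply: eq_integral => t _.
  rewrite patchE; case: ifPn => // /negP; rewrite inE => tc.
  by rewrite k'0.
have kc t : {for t, continuous k}.
  exact/differentiable_continuous/derivable1_diffP.
rewrite (@continuous_FTC2 _ _ k).
- rewrite !k0 ?subee// ?normrN ger0_norm// ltW//.
- by rewrite gtrN.
- exact: continuous_subspaceT.
- split => [t _ //||].
    by apply: cvg_at_right_filter; exact: kc.
  by apply: cvg_at_left_filter; exact: kc.
- by move=> t _.
Qed.

Section slices.
Context (R : realType) (n : nat) (h : 'rV[R]_n.+1 -> R).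

Lemma rV_consDr t x (j : 'I_n) (s : R) :
  rV_cons (t, s *: delta_mx 0 j + x) = s *: delta_mx 0 (lift ord0 j) + rV_cons (t, x).
Proof.
apply/rowP => i; rewrite /rV_cons !mxE /=; case: (unliftP ord0 i) => [k|] -> /=.
  by rewrite !mxE (inj_eq (@lift_inj _ _)).
by rewrite mulr0 add0r.
Qed.

Lemma rV_consDl t (x : 'rV[R]_n) (s : R) :
  rV_cons (s * 1 + t, x) = s *: delta_mx 0 ord0 + rV_cons (t, x).
Proof.
apply/rowP => i; rewrite /rV_cons !mxE /=; case: (unliftP ord0 i) => [k|] -> /=.
  by rewrite mulr0 add0r.
by [].
Qed.

(** Equating the whole difference quotients transfers derivability and the value of the derivative
    at once. *)
Lemma sliceE t x (j : 'I_n) :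
  (fun s : R => s^-1 *: (((fun y => h (rV_cons (t, y))) \o shift x) (s *: delta_mx 0 j)
     - h (rV_cons (t, x)))) =
  (fun s : R => s^-1 *: ((h \o shift (rV_cons (t, x))) (s *: delta_mx 0 (lift ord0 j))
     - h (rV_cons (t, x)))).
Proof. by apply/funext => s /=; rewrite rV_consDr. Qed.

Lemma slice1E t (x : 'rV[R]_n) :
  (fun s : R => s^-1 *: (((fun t => h (rV_cons (t, x))) \o shift t) (s *: 1)
     - h (rV_cons (t, x)))) =
  (fun s : R => s^-1 *: ((h \o shift (rV_cons (t, x))) (s *: delta_mx 0 ord0)
     - h (rV_cons (t, x)))).
Proof. by apply/funext => s /=; rewrite rV_consDl. Qed.

Lemma rV_cons_cvg (T : Type) (F : set_system T) (FF : Filter F) (f : T -> R)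
    (g : T -> 'rV[R]_n) t x :
  f @ F --> t -> g @ F --> x ->
  (fun y => rV_cons (f y, g y)) @ F --> rV_cons (t, x).
Proof.
move=> ft gx; apply: cvg_rV => i; rewrite /rV_cons mxE.
under eq_fun do rewrite mxE.
case: (unlift ord0 i) => [j|] //=.
apply: (cvg_comp _ (fun y : 'rV[R]_n => y 0 j) gx).
exact: coord_continuous.
Qed.

End slices.

Lemma integral_lebS (R : realType) (n : nat) (F : 'rV[R]_n.+1 -> \bar R) :
  measurable_fun setT F ->
  (lebesgue_measure \x leb R n)%E.-integrable setT (F \o @rV_cons R n) ->
  (\int[leb R n.+1]_x F x = \int[lebesgue_measure \x leb R n]_z F (rV_cons z))%E.
Proof.
move=> mF iF.
pose mu : {measure set (measurableTypeR R * 'rV[R]_n) -> \bar R} :=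
  (lebesgue_measure \x leb R n)%E.
have mr : measurable_fun [set: measurableTypeR R * 'rV[R]_n] (@rV_cons R n).
  exact: measurable_rV_cons.
exact: (@integral_pushforward _ _ (measurableTypeR R * 'rV[R]_n)%type _ R
  (@rV_cons R n) mr mu setT F mF iF measurableT).
Qed.

Lemma rV_cons_norm (R : realType) (n : nat) (t : R) (x : 'rV[R]_n) :
  `|t| <= `|rV_cons (t, x)| /\ `|x| <= `|rV_cons (t, x)|.
Proof.
split.
  have := coord_le_norm (rV_cons (t, x)) ord0.
  by rewrite {1}/rV_cons mxE unlift_none.
apply: norm_le_coord => // j.
have := coord_le_norm (rV_cons (t, x)) (lift ord0 j).
by rewrite {1}/rV_cons mxE liftK.
Qed.

(** Fubini and induction on the dimension. The hypotheses concern only the derivative in direction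
    [i], so they pass to slices as they stand. *)
Lemma integral_pderiv_eq0 (R : realType) (n : nat) (h : 'rV[R]_n -> R) (i : 'I_n) (r : R) :
  (forall x, derivable h x (delta_mx 0 i)) -> continuous (pderiv i h) ->
  (forall x : 'rV[R]_n, r < `|x| -> h x = 0) ->
  (\int[leb R n]_x (pderiv i h x)%:E = 0)%E.
Proof.
elim: n h i => [|n IH] h i dh ch h0; first by have [] := i.
have p0 x : r < `|x| -> pderiv i h x = 0.
  move=> rx; apply: near_eq0_derive.
  by apply: filterS (near_norm_gt rx) => y; exact: h0.
have mp : measurable_fun setT (fun x => (pderiv i h x)%:E).
  by apply/measurable_EFinP; exact: continuous_measurable_rV.
have ip : (leb R n.+1).-integrable setT (fun x => (pderiv i h x)%:E).
  (* Integrability, which Fubini requires: the derivative is continuous, hence bounded on this cube,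
     and vanishes outside it. *)
  pose c : 'rV[R]_n.+1 := const_mx r.
  have mc : measurable (cbox (- c) c) by exact: measurable_cbox.
  rewrite (_ : (fun x => _) = (EFin \o pderiv i h) \_ (cbox (- c) c)); last first.
    apply/funext => x; rewrite patchE; case: ifPn => // /negP; rewrite inE => nx.
    rewrite p0// ltNge; apply/negP => xr; apply: nx => j; rewrite !mxE -ler_norml.
    exact: le_trans (coord_le_norm _ _) xr.
  rewrite -integrable_mkcond//; apply: measurable_bounded_integrable => //.
  - exact: leb_cbox_lty.
  - by apply: measurable_funTS; exact/measurable_EFinP.
  - have [C HC] := continuous_bounded_rV ch (bounded_cbox (- c) c).
    exists C; split; first exact: num_real.
    by move=> M CM x /HC; move/le_trans; apply; exact: ltW.
have icons : (lebesgue_measure \x leb R n)%E.-integrable setT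
    ((fun x => (pderiv i h x)%:E) \o @rV_cons R n).
  have /integrableP[_ ilt] := ip.
  pose mu : {measure set (measurableTypeR R * 'rV[R]_n) -> \bar R} :=
    (lebesgue_measure \x leb R n)%E.
  have mr : measurable_fun [set: measurableTypeR R * 'rV[R]_n] (@rV_cons R n).
    exact: measurable_rV_cons.
  apply/integrableP; split; first exact: measurableT_comp mp mr.
  have E := @ge0_integral_pushforward _ _ (measurableTypeR R * 'rV[R]_n)%type _ R
    (@rV_cons R n) mr mu setT (fun x => `|(pderiv i h x)%:E|%E) measurableT.
  apply: le_lt_trans ilt; rewrite le_eqVlt; apply/orP; left; apply/eqP/esym.
  by apply: E => //; exact: measurableT_comp.
rewrite integral_lebS//.
case: (unliftP ord0 i) => [j|] ei.
  (* The direction lies in the tail: with the first coordinate frozen, the inner integral falls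
     under the induction hypothesis. *)
  rewrite -(@integral12_prod_meas1 _ _ _ _ _ _ _ _ icons) /fubini_F /=.
  apply: integral0_eq => t _.
  have D x : derivable (fun y => h (rV_cons (t, y))) x (delta_mx 0 j).
    by rewrite /derivable sliceE -ei; exact: dh.
  have E x : pderiv i h (rV_cons (t, x)) = pderiv j (fun y => h (rV_cons (t, y))) x.
    by rewrite /pderiv [RHS]/derive sliceE -ei.
  under eq_integral do rewrite E.
  apply: IH => //.
  - rewrite (_ : pderiv j _ = (fun x => pderiv i h (rV_cons (t, x)))); last exact/funext.
    move=> x; apply: (cvg_comp _ (pderiv i h)); last exact: ch.
    apply: (@rV_cons_cvg R n _ (nbhs x) _ (fun=> t : R) id); [exact: cvg_cst|exact: cvg_id].
  - move=> x rx; apply: h0; apply: lt_le_trans rx _.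
    by have [] := rV_cons_norm t x.
(* The direction is the first coordinate: it is integrated first, which is the one-dimensional
   case. *)
rewrite -(@integral21_prod_meas1 _ _ _ _ _ _ _ _ icons) /fubini_G /=.
apply: integral0_eq => x _.
have D t : derivable (fun t => h (rV_cons (t, x))) t 1.
  by rewrite /derivable slice1E -ei; exact: dh.
have E t : pderiv i h (rV_cons (t, x)) = derive1 (fun t => h (rV_cons (t, x))) t.
  by rewrite derive1E /pderiv [RHS]/derive slice1E -ei.
under eq_integral do rewrite E.
apply: (@integral_derive1_eq0 R (fun t => h (rV_cons (t, x))) r D).
- rewrite (_ : derive1 _ = (fun t => pderiv i h (rV_cons (t, x)))); last exact/funext.
  move=> t; apply: (cvg_comp _ (pderiv i h)); last exact: ch.
  apply: (@rV_cons_cvg R n _ (nbhs t) _ id (fun=> x)); [exact: cvg_id|exact: cvg_cst].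
- move=> t rt; apply: h0; apply: lt_le_trans rt _.
  by have [] := rV_cons_norm t x.
Qed.

(** * L^2 and weak gradients *)

Section ae_on_theory.
Context (R : realType) (n : nat).
Implicit Types (D : set 'rV[R]_n) (P Q S : 'rV[R]_n -> Prop).

Lemma ae_onW D P : (forall x, D x -> P x) -> ae_on D P.
Proof. exact: aeW. Qed.

Lemma ae_onS D P Q : (forall x, D x -> P x -> Q x) -> ae_on D P -> ae_on D Q.
Proof. by move=> PQ; rewrite /ae_on; apply: filterS => x DP Dx; exact: PQ (DP Dx). Qed.

Lemma ae_onS2 D P Q S : (forall x, D x -> P x -> Q x -> S x) ->
  ae_on D P -> ae_on D Q -> ae_on D S.
Proof.
by move=> PQS; rewrite /ae_on; apply: filterS2 => x DP DQ Dx; exact: PQS (DP Dx) (DQ Dx).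
Qed.

Lemma ae_on_sub D D' P : D' `<=` D -> ae_on D P -> ae_on D' P.
Proof. by move=> D'D; rewrite /ae_on; apply: filterS => x DP /D'D. Qed.

Lemma ae_on_sym (T : Type) D (f g : 'rV[R]_n -> T) :
  ae_on D (fun x => f x = g x) -> ae_on D (fun x => g x = f x).
Proof. exact: ae_onS. Qed.

End ae_on_theory.

Lemma Rintegral_ae (R : realType) (n : nat) (D : set 'rV[R]_n) (f g : 'rV[R]_n -> R) :
  ae_on D (fun x => f x = g x) ->
  \int[leb R n]_(x in D) f x = \int[leb R n]_(x in D) g x.
Proof.
move=> fg; rewrite /Rintegral (@ae_eq_lower_integral _ _ _ _ _ _ (EFin \o g))//.
by apply: ae_onS fg => x _ /= ->.
Qed.

Section L2_theory.
Context (R : realType) (n : nat) (D : set 'rV[R]_n) (mD : measurable D).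
Implicit Types (v w f g : 'rV[R]_n -> R).
Local Notation mu := (leb R n).

Lemma L2_mul f g : L2 D f -> L2 D g -> mu.-integrable D (EFin \o (f \* g)).
Proof.
move=> [mf If] [mg Ig]; apply: (le_integrable mD _ _ (integrableD mD If Ig)).
  by apply/measurable_EFinP; exact: measurable_funM.
move=> x _ /=; rewrite lee_fin normrM (ger0_norm (addr_ge0 (sqr_ge0 _) (sqr_ge0 _))).
rewrite -(real_normK (num_real (f x))) -(real_normK (num_real (g x))).
have := sqr_ge0 (`|f x| - `|g x|).
have := mulr_ge0 (normr_ge0 (f x)) (normr_ge0 (g x)).
by rewrite !expr2 => *; lra.
Qed.

Lemma L2_lin (c : R) f g : L2 D f -> L2 D g -> L2 D (fun x => c * f x + g x).
Proof.
move=> Lf Lg; have [mf If] := Lf; have [mg Ig] := Lg; split.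
  by apply: measurable_funD => //; exact: measurable_funM.
have I := integrableD mD (integrableZl mD (c ^+ 2)
  If) (integrableD mD (integrableZl mD (2 * c) (L2_mul Lf Lg)) Ig).
apply: eq_integrable I => // x _ /=.
by rewrite -!EFinM -!EFinD; congr EFin; ring.
Qed.

Lemma L2B f g : L2 D f -> L2 D g -> L2 D (f \- g).
Proof.
move=> Lf Lg; have := L2_lin (-1) Lg Lf.
by congr L2; apply/funext => x; rewrite mulN1r addrC.
Qed.

Lemma L2D f g : L2 D f -> L2 D g -> L2 D (f \+ g).
Proof.
move=> Lf Lg; have := L2_lin 1 Lf Lg.
by congr L2; apply/funext => x; rewrite mul1r.
Qed.

Lemma ipC f g : ip D f g = ip D g f.
Proof. by rewrite /ip; apply: eq_Rintegral => x _; rewrite mulrC. Qed.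

Lemma ip_linl (c : R) f g h : L2 D f -> L2 D g -> L2 D h ->
  ip D (fun x => c * f x + g x) h = c * ip D f h + ip D g h.
Proof.
move=> Lf Lg Lh; rewrite /ip -RintegralZl//; last exact: L2_mul.
rewrite -RintegralD//.
- by apply: eq_Rintegral => x _; ring.
- by have := integrableZl mD c (L2_mul Lf Lh).
- exact: L2_mul.
Qed.

Lemma ip_linr (c : R) f g h : L2 D f -> L2 D g -> L2 D h ->
  ip D h (fun x => c * f x + g x) = c * ip D h f + ip D h g.
Proof. by move=> Lf Lg Lh; rewrite ipC ip_linl// !(ipC h). Qed.

Lemma ipBl f g h : L2 D f -> L2 D g -> L2 D h ->
  ip D (f \- g) h = ip D f h - ip D g h.
Proof.
move=> Lf Lg Lh; rewrite (_ : f \- g = fun x => -1 * g x + f x).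
  by rewrite ip_linl// mulN1r addrC.
by apply/funext => x /=; rewrite mulN1r addrC.
Qed.

Lemma ipBr f g h : L2 D f -> L2 D g -> L2 D h ->
  ip D h (f \- g) = ip D h f - ip D h g.
Proof. by move=> Lf Lg Lh; rewrite ipC ipBl// !(ipC h). Qed.

Lemma ip_ge0 f : 0 <= ip D f f.
Proof. by apply: Rintegral_ge0 => x _; rewrite -expr2 sqr_ge0. Qed.

(** By the parallelogram identity, right side minus left side is the squared norm of [f + g]. *)
Lemma ip_sub_le f g : L2 D f -> L2 D g ->
  ip D (f \- g) (f \- g) <= 2 * ip D f f + 2 * ip D g g.
Proof.
move=> Lf Lg; have LB := L2B Lf Lg; have LS := L2D Lf Lg.
have := ip_ge0 (f \+ g).
have -> : f \+ g = fun x => 1 * f x + g x by apply/funext => x; rewrite mul1r.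
rewrite ip_linl// ?ip_linr//; last by exact: L2_lin.
rewrite ipBl// !ipBr// (ipC g f) => H; lra.
Qed.

Lemma ip_ae f f' g g' : ae_on D (fun x => f x = f' x) ->
  ae_on D (fun x => g x = g' x) -> ip D f g = ip D f' g'.
Proof.
by move=> ff' gg'; apply: Rintegral_ae; apply: ae_onS2 ff' gg' => x _ -> ->.
Qed.

Lemma Linfty_L2 f : (mu D < +oo)%E -> Linfty D f -> L2 D f.
Proof.
move=> Dfin [mf [C HC]]; split => //; apply/integrableP; split.
  by apply/measurable_EFinP; exact: measurable_funX.
apply: (@le_lt_trans _ _ (\int[mu]_(x in D) (C ^+ 2)%:E)%E).
  apply: ge0_ae_le_integral => [x _|x _|]; rewrite ?lee_fin ?sqr_ge0//.
  apply: ae_onS HC => x _ H.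
  by rewrite /= normrX lee_fin lerXn2r// ?nnegrE// (le_trans _ H).
by rewrite integral_cst// lte_mul_pinfty// lee_fin sqr_ge0.
Qed.

Lemma L2_ip_eq0 f : L2 D f -> ip D f f = 0 -> ae_on D (fun x => f x = 0).
Proof.
move=> [mf If] H.
have H2 : (\int[mu]_(x in D) `|(f x ^+ 2)%:E| = 0)%E.
  under eq_integral do rewrite gee0_abs ?lee_fin ?sqr_ge0//.
  rewrite -[LHS]fineK; last exact: integrable_fin_num.
  rewrite -[RHS]/(0%:E) -H /ip /Rintegral.
  by under [in RHS]eq_integral do rewrite -expr2.
have := (ae_eq_integral_abs mu mD ((measurable_EFinP _ _).2 (measurable_funX 2 mf))).1 H2.
apply: filterS => x /[apply] /= -[/eqP].
by rewrite sqrf_eq0 => /eqP.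
Qed.

Lemma L2S (D' : set 'rV[R]_n) f : measurable D' -> D' `<=` D -> L2 D f -> L2 D' f.
Proof.
move=> mD' D'D [mf If]; split; first exact: measurable_funS mf.
exact: integrableS If.
Qed.

Lemma L2_ae f g : measurable_fun D f -> ae_on D (fun x => f x = g x) -> L2 D g -> L2 D f.
Proof.
move=> mf fg [mg Ig]; split => //.
have /integrableP[_ Ig2] := Ig; apply/integrableP; split.
  by apply/measurable_EFinP; exact: measurable_funX.
rewrite (@ae_eq_lower_integral _ _ _ _ _ _ (fun x => `|(g x ^+ 2)%:E|%E))//.
by apply: ae_onS fg => x _ ->.
Qed.

End L2_theory.

Lemma Linfty_continuous (R : realType) (n : nat) (D : set 'rV[R]_n) f :
  bounded_set D -> continuous f -> Linfty D f.
Proof.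
move=> bD cf; split; first by apply: measurable_funTS; exact: continuous_measurable_rV.
by have [C HC] := continuous_bounded_rV cf bD; exists C; apply: aeW.
Qed.

Lemma lerD_lin2 (R : realType) (a b c d e f : R) :
  a <= 2 * b + 2 * c -> d <= 2 * e + 2 * f -> a + d <= 2 * (b + e) + 2 * (c + f).
Proof. by lra. Qed.

Lemma ler_sum_lin2 (R : realType) (I : finType) (a b c : I -> R) :
  (forall i, c i <= 2 * a i + 2 * b i) ->
  \sum_i c i <= 2 * (\sum_i a i) + 2 * (\sum_i b i).
Proof.
by move=> H; rewrite !mulr_sumr -big_split; apply: ler_sum => i _; exact: H.
Qed.

Section weak_gradient.
Context (R : realType) (n : nat) (D : set 'rV[R]_n).
Hypotheses (oD : open D) (bD : bounded_set D).
Implicit Types (v w z : 'rV[R]_n -> R) (g : 'rV[R]_n -> 'rV[R]_n).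

Let mD : measurable D. Proof. exact: open_measurable_rV. Qed.
Let fD : (leb R n D < +oo)%E. Proof. exact: leb_bounded_lty. Qed.

Lemma smooth_L2 z : smooth z -> L2 D z.
Proof.
by move=> /smooth_continuous cz; apply: Linfty_L2 => //; exact: Linfty_continuous.
Qed.

Lemma test_fun_L2 z : test_fun D z -> L2 D z.
Proof. by move=> [sz _ _]; exact: smooth_L2. Qed.

Lemma H1_wgrad v : H1 D v -> is_wgrad D v (wgrad D v).
Proof. by move=> [_ [g Hg]]; rewrite /wgrad; apply: xgetPex; exists g. Qed.

Lemma is_wgrad_ae v v' g : ae_on D (fun x => v x = v' x) ->
  is_wgrad D v g -> is_wgrad D v' g.
Proof.
move=> vv' [Lg Hg]; split => // z tz i; rewrite -Hg//; apply: ip_ae.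
  exact: ae_on_sym.
exact: ae_onW.
Qed.

Lemma is_wgrad_lin (c : R) v w g h : L2 D v -> L2 D w ->
  is_wgrad D v g -> is_wgrad D w h ->
  is_wgrad D (fun x => c * v x + w x) (fun x => c *: g x + h x).
Proof.
move=> Lv Lw [Lg Hg] [Lh Hh].
have E i : (fun x => (c *: g x + h x) 0 i) = fun x => c * g x 0 i + h x 0 i.
  by apply/funext => x; rewrite !mxE.
split=> [i|z tz i]; rewrite E; first exact: L2_lin.
have Lz : L2 D (pderiv i z) by apply: smooth_L2; apply: smooth_pderiv; case: tz.
rewrite !ip_linl// ?Hg ?Hh//; last exact: test_fun_L2.
by rewrite mulrN opprD.
Qed.

(** The difference of two candidates is orthogonal, component by component, to all test functions.
    Since [wgrad] is an arbitrary choice, every algebraic rule for it rests on this. *)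
Lemma is_wgrad_unique v g h : is_wgrad D v g -> is_wgrad D v h ->
  ae_on D (fun x => g x = h x).
Proof.
move=> [Lg Hg] [Lh Hh].
suff H i : ae_on D (fun x => g x 0 i - h x 0 i = 0).
  have : {ae leb R n, forall x, forall i, D x -> g x 0 i - h x 0 i = 0}.
    exact: ae_forall_countable.
  by apply: filterS => x H' Dx; apply/rowP => i; apply/eqP; rewrite -subr_eq0 H'.
have LB := L2B mD (Lg i) (Lh i).
apply: (test_ortho_ae0 oD) => [|a b abD|z tz].
- by case: LB.
- have mab := measurable_cbox a b.
  have LBc := L2S mD mab abD LB.
  have L1 : L2 (cbox a b) (cst 1).
    apply: Linfty_L2 => //; first exact: leb_cbox_lty.
    by split => //; exists 1; apply: aeW => x _; rewrite normr1.
  have := L2_mul mab (LBc) L1.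
  by apply: eq_integrable => // x _ /=; rewrite mulr1.
- rewrite (ipBl mD (Lg i) (Lh i) (test_fun_L2 tz)).
  by have := Hg z tz i; rewrite Hh// => /oppr_inj ->; rewrite subrr.
Qed.

(** [f] is only almost everywhere the combination, because the reconstruction and the conforming
    operator are linear in that sense only. *)
Lemma wgrad_lin (c : R) v w f : H1 D v -> H1 D w ->
  ae_on D (fun x => f x = c * v x + w x) ->
  is_wgrad D f (fun x => c *: wgrad D v x + wgrad D w x) /\
  ae_on D (fun x => wgrad D f x = c *: wgrad D v x + wgrad D w x).
Proof.
move=> Hv Hw fE.
have W : is_wgrad D f (fun x => c *: wgrad D v x + wgrad D w x).
  apply: (@is_wgrad_ae (fun x => c * v x + w x)).
    exact: ae_on_sym.
  by apply: is_wgrad_lin; [case: Hv|case: Hw|exact: H1_wgrad|exact: H1_wgrad].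
split => //; apply: (is_wgrad_unique _ W).
by rewrite /wgrad; apply: xgetPex; eexists; exact: W.
Qed.

Lemma H1_lin (c : R) v w : H1 D v -> H1 D w -> H1 D (fun x => c * v x + w x).
Proof.
move=> Hv Hw; split; first by apply: L2_lin; [|case: Hv|case: Hw].
by eexists; apply: (wgrad_lin Hv Hw (aeW _ (fun x _ => erefl))).1.
Qed.

Lemma H1B v w : H1 D v -> H1 D w -> H1 D (v \- w).
Proof.
move=> Hv Hw; have := H1_lin (-1) Hw Hv.
by congr H1; apply/funext => x; rewrite mulN1r addrC.
Qed.

Lemma H1_ae v w : measurable_fun D v -> ae_on D (fun x => v x = w x) -> H1 D w -> H1 D v.
Proof.
move=> mv vw [Lw [g Wg]]; split; first exact: L2_ae vw Lw.
by exists g; apply: is_wgrad_ae Wg; exact: ae_on_sym.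
Qed.

Definition gcoord g (i : 'I_n) : 'rV[R]_n -> R := fun x => g x 0 i.

Lemma integral_dotv g h : (forall i, L2 D (gcoord g i)) -> (forall i, L2 D (gcoord h i)) ->
  \int[leb R n]_(x in D) dotv (g x) (h x) = \sum_i ip D (gcoord g i) (gcoord h i).
Proof.
move=> Lg Lh; rewrite /ip /dotv.
suff H (s : seq 'I_n) : (leb R n).-integrable D (EFin \o (fun x => \sum_(i <- s) g x 0 i * h x 0 i)) /\
    \int[leb R n]_(x in D) (\sum_(i <- s) g x 0 i * h x 0 i) =
    \sum_(i <- s) \int[leb R n]_(x in D) (gcoord g i x * gcoord h i x).
  by have [] := H (index_enum _).
elim: s => [|i s [I1 E1]].
  under eq_fun do rewrite big_nil.
  rewrite big_nil; split; first exact: integrable0.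
  by rewrite Rintegral_cst// mul0r.
have I2 := L2_mul mD (Lg i) (Lh i).
have E : (fun x => \sum_(i <- i :: s) g x 0 i * h x 0 i) =
   fun x => gcoord g i x * gcoord h i x + \sum_(i <- s) g x 0 i * h x 0 i.
  by apply/funext => x; rewrite big_cons.
rewrite E; split; first by have := integrableD mD I2 I1.
by rewrite RintegralD// big_cons E1.
Qed.

Lemma H1_gcoord v i : H1 D v -> L2 D (gcoord (wgrad D v) i).
Proof. by move=> /H1_wgrad[Lv _]; exact: Lv. Qed.

Lemma adirE v w : H1 D v -> H1 D w ->
  adir D v w = \sum_i ip D (gcoord (wgrad D v) i) (gcoord (wgrad D w) i).
Proof. by move=> Hv Hw; rewrite /adir integral_dotv// => i; exact: H1_gcoord. Qed.

Lemma wgrad_ae v w : ae_on D (fun x => v x = w x) ->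
  ae_on D (fun x => wgrad D v x = wgrad D w x).
Proof.
move=> vw; have [Hv|nv] := pselect (exists g, is_wgrad D v g).
  have Wv : is_wgrad D v (wgrad D v) by rewrite /wgrad; exact: xgetPex.
  have Wv2 := is_wgrad_ae vw Wv.
  by apply: (is_wgrad_unique Wv2); rewrite /wgrad; apply: xgetPex; eexists; exact: Wv2.
(* Neither function has a weak gradient, so both choices fall back on the default 0. *)
apply: ae_onW => x _; rewrite /wgrad !xgetPN// => g Hg; apply: nv; exists g => //.
by apply: is_wgrad_ae Hg; exact: ae_on_sym.
Qed.

Lemma adir_ae u v w : ae_on D (fun x => v x = w x) -> adir D u v = adir D u w.
Proof.
move=> /wgrad_ae vw; apply: Rintegral_ae.
by apply: ae_onS vw => x _ ->.
Qed.

Lemma adir_linr (c : R) u v w f : H1 D u -> H1 D v -> H1 D w ->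
  ae_on D (fun x => f x = c * v x + w x) ->
  adir D u f = c * adir D u v + adir D u w.
Proof.
move=> Hu Hv Hw fE; rewrite (adir_ae _ fE).
have Hf := H1_lin c Hv Hw.
have [_ W] := wgrad_lin Hv Hw (ae_onW (fun x _ => erefl (c * v x + w x))).
rewrite !adirE// mulr_sumr -big_split; apply: eq_bigr => i _ /=.
rewrite -(ip_linr mD)//; try exact: H1_gcoord.
apply: ip_ae; first exact: ae_onW.
by apply: ae_onS W => x _; rewrite /gcoord => ->; rewrite !mxE.
Qed.

Lemma adirC v w : adir D v w = adir D w v.
Proof.
rewrite /adir; apply: eq_Rintegral => x _; rewrite /dotv.
by apply: eq_bigr => i _; rewrite mulrC.
Qed.

Lemma adir_ge0 v : 0 <= adir D v v.
Proof.
apply: Rintegral_ge0 => x _; rewrite /dotv; apply: sumr_ge0 => i _.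
by rewrite -expr2 sqr_ge0.
Qed.

Lemma adir_sub_le v w f : H1 D v -> H1 D w ->
  ae_on D (fun x => f x = v x - w x) ->
  adir D f f <= 2 * adir D v v + 2 * adir D w w.
Proof.
move=> Hv Hw fE; have HB := H1B Hv Hw.
have fE' : ae_on D (fun x => (v \- w) x = -1 * w x + v x).
  by apply: ae_onW => x _ /=; rewrite mulN1r addrC.
have pE : ae_on D (fun x => (v \+ w) x = 1 * w x + v x).
  by apply: ae_onW => x _ /=; rewrite mul1r addrC.
have HD : H1 D (v \+ w).
  have := H1_lin 1 Hw Hv.
  by congr H1; apply/funext => x /=; rewrite mul1r addrC.
rewrite (adir_ae _ fE) adirC (adir_ae _ fE) -/(v \- w).
rewrite (adir_linr HB Hw Hv fE') !(adirC (v \- w)) (adir_linr Hw Hw Hv fE') (adir_linr Hv Hw Hv fE').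
have := adir_ge0 (v \+ w).
rewrite (adir_linr HD Hw Hv pE) !(adirC (v \+ w)) (adir_linr Hw Hw Hv pE) (adir_linr Hv Hw Hv pE).
rewrite (adirC v w).
by move: (adir D w v) (adir D w w) (adir D v v) => a b c H; lra.
Qed.

Lemma smooth_grad z i : smooth z -> L2 D (gcoord (grad z) i).
Proof.
move=> sz; rewrite (_ : gcoord _ i = pderiv i z).
  by apply: smooth_L2; exact: smooth_pderiv.
by apply/funext => x; rewrite /gcoord mxE.
Qed.

Lemma H1dist_sqrE z v : smooth z -> H1 D v ->
  H1dist_sqr D z v = ip D (z \- v) (z \- v) +
    \sum_i ip D (gcoord (grad z) i \- gcoord (wgrad D v) i)
      (gcoord (grad z) i \- gcoord (wgrad D v) i).
Proof.
move=> sz Hv.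
have E i : gcoord (fun x => grad z x - wgrad D v x) i =
    gcoord (grad z) i \- gcoord (wgrad D v) i.
  by apply/funext => x; rewrite /gcoord /= /grad !mxE.
have LE i : L2 D (gcoord (fun x => grad z x - wgrad D v x) i).
  by rewrite E; apply: L2B => //; [exact: smooth_grad|exact: H1_gcoord].
rewrite /H1dist_sqr (integral_dotv LE LE).
by under eq_bigr do rewrite E.
Qed.

Lemma H1dist_sqr_ge0 z v : 0 <= H1dist_sqr D z v.
Proof.
rewrite /H1dist_sqr addr_ge0 ?ip_ge0//; apply: Rintegral_ge0 => x _.
by rewrite /dotv; apply: sumr_ge0 => i _; rewrite -expr2 sqr_ge0.
Qed.

Lemma H1dist_sqr_ae z v w : ae_on D (fun x => v x = w x) ->
  H1dist_sqr D z v = H1dist_sqr D z w.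
Proof.
move=> vw; rewrite /H1dist_sqr.
have E1 : ae_on D (fun x => (z \- v) x = (z \- w) x).
  by apply: ae_onS vw => x _ /= ->.
have E2 : ae_on D (fun x => dotv (grad z x - wgrad D v x) (grad z x - wgrad D v x) =
    dotv (grad z x - wgrad D w x) (grad z x - wgrad D w x)).
  by apply: ae_onS (wgrad_ae vw) => x _ ->.
by rewrite (ip_ae E1 E1) (Rintegral_ae E2).
Qed.

Lemma H1dist_sqr_sub_le z y v w : smooth z -> smooth y -> H1 D v -> H1 D w ->
  H1dist_sqr D (z \- y) (v \- w) <= 2 * H1dist_sqr D z v + 2 * H1dist_sqr D y w.
Proof.
move=> sz sy Hv Hw; have HB := H1B Hv Hw; have sB := smoothB sz sy.
have Lv : L2 D v by case: Hv.
have Lw : L2 D w by case: Hw.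
have Lz := smooth_L2 sz; have Ly := smooth_L2 sy.
have K1 := ip_sub_le mD (L2B mD Lz Lv) (L2B mD Ly Lw).
have E0 : (z \- v) \- (y \- w) = (z \- y) \- (v \- w).
  by apply/funext => x /=; ring.
rewrite E0 in K1.
pose A i := gcoord (grad z) i \- gcoord (wgrad D v) i.
pose B i := gcoord (grad y) i \- gcoord (wgrad D w) i.
pose C i := gcoord (grad (z \- y)) i \- gcoord (wgrad D (v \- w)) i.
have LA i : L2 D (A i) by apply: L2B => //; [exact: smooth_grad|exact: H1_gcoord].
have LB i : L2 D (B i) by apply: L2B => //; [exact: smooth_grad|exact: H1_gcoord].
have fE' : ae_on D (fun x => (v \- w) x = -1 * w x + v x).
  by apply: ae_onW => x _ /=; rewrite mulN1r addrC.
have [_ W] := wgrad_lin Hw Hv fE'.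
have CE i : ae_on D (fun x => C i x = (A i \- B i) x).
  apply: ae_onS W => x _; rewrite /C /A /B /gcoord /= => ->.
  rewrite !mxE (_ : pderiv i (z \- y) x = pderiv i z x - pderiv i y x); first by ring.
  by apply: deriveB; exact: smooth_derivable.
have K2 : \sum_i ip D (C i) (C i) <=
    2 * (\sum_i ip D (A i) (A i)) + 2 * (\sum_i ip D (B i) (B i)).
  apply: ler_sum_lin2 => i.
  by rewrite (ip_ae (CE i) (CE i)); exact: ip_sub_le.
rewrite (H1dist_sqrE sB HB) (H1dist_sqrE sz Hv) (H1dist_sqrE sy Hw).
exact: lerD_lin2 K1 K2.
Qed.

(** Integration by parts: the product of [z] with a test function has compact support, so its
    partial derivative has null integral over the whole space, and the product rule splits it. *)
Lemma is_wgrad_smooth z : smooth z -> is_wgrad D z (grad z).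
Proof.
move=> sz; split=> [i|y ty i]; first exact: smooth_grad.
have sy : smooth y by case: ty.
have dz x : derivable z x (delta_mx 0 i) by exact: smooth_derivable.
have dy x : derivable y x (delta_mx 0 i) by exact: smooth_derivable.
have Lz := smooth_L2 sz; have Ly := smooth_L2 sy.
have Lpz := smooth_L2 (smooth_pderiv i sz); have Lpy := smooth_L2 (smooth_pderiv i sy).
rewrite (_ : (fun x => grad z x 0 i) = pderiv i z); last by apply/funext => x; rewrite mxE.
apply/eqP; rewrite -addr_eq0 (ipC _ (pderiv i z)).
case: ty => _ /compact_bounded[M [_ HM]] supp.
have nD x : ~ closure [set x | y x != 0] x -> y x = 0.
  move=> nx; apply/eqP; apply: contrapT => /negP yx; apply: nx.
  exact: subset_closure.
have szy : smooth (z \* y) by exact: smoothM.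
have H0 : (\int[leb R n]_x (pderiv i (z \* y) x)%:E = 0)%E.
  apply: (@integral_pderiv_eq0 _ _ _ _ (M + 1)).
  - by move=> x; exact: smooth_derivable.
  - exact/smooth_continuous/smooth_pderiv.
  - move=> x Mx /=; rewrite nD ?mulr0// => /(HM (M + 1)).
    by rewrite ltrDl ltr01 => /(_ isT) /=; rewrite leNgt Mx.
have E : pderiv i (z \* y) = (z \* pderiv i y) \+ (y \* pderiv i z) by exact: pderivM.
rewrite /ip -RintegralD//; try exact: L2_mul.
have H1 : \int[leb R n]_x (pderiv i (z \* y) x) = 0 by rewrite /Rintegral H0.
(* The integral over [D] equals the one over the whole space: a point outside [D] has a
   neighbourhood missing the support of [y], where the product is constantly 0. *)
apply/eqP; rewrite -[RHS]H1 /Rintegral integral_mkcond.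
suff -> : (fun x => (z x * pderiv i y x + y x * pderiv i z x)%:E) \_ D =
    fun x => (pderiv i (z \* y) x)%:E by [].
apply/funext => x; rewrite E patchE.
case: ifPn => [_ //|].
move=> /negP; rewrite inE => nDx; congr EFin.
suff : pderiv i (z \* y) x = 0 by rewrite E.
apply: near_eq0_derive.
have : \forall y' \near x, (~` closure [set x | y x != 0]) y'.
  apply: open_nbhs_nbhs; split; first exact/closed_openC/closed_closure.
  by move=> /supp.
by apply: filterS => y' /nD /= ->; rewrite mulr0.
Qed.

End weak_gradient.

(** * Lipschitz domains and broken polynomials *)

Lemma continuous_rVP (R : realType) (n m : nat) (f : 'rV[R]_n -> 'rV[R]_m) :
  (forall i, continuous (fun y => f y 0 i)) -> continuous f.
Proof.
by move=> H x; apply: (@cvg_rV R m _ (nbhs x) (nbhs_filter x)) => i; exact: H.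
Qed.

Section euclidean_theory.
Context (R : realType) (n : nat).
Implicit Types x y e : 'rV[R]_n.

Lemma dotvDl x y e : dotv (x + y) e = dotv x e + dotv y e.
Proof.
by rewrite /dotv -big_split; apply: eq_bigr => i _; rewrite mxE mulrDl.
Qed.

Lemma dotvZl (c : R) x e : dotv (c *: x) e = c * dotv x e.
Proof.
by rewrite /dotv mulr_sumr; apply: eq_bigr => i _; rewrite mxE mulrA.
Qed.

Lemma smooth_dotv e : smooth (fun x => dotv x e).
Proof.
apply: smooth_sum => i _; apply: (smoothM (g := cst (e 0 i))).
  exact: smooth_coord.
exact: smooth_cst.
Qed.

Lemma enorm0 : enorm (0 : 'rV[R]_n) = 0.
Proof.
by rewrite /enorm /dotv big1 ?sqrtr0// => i _; rewrite mxE mul0r.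
Qed.

Lemma enorm_continuous : continuous (@enorm R n).
Proof.
move=> x; apply: (@continuous_comp _ _ _ (fun x : 'rV[R]_n => dotv x x) Num.sqrt).
  apply: (@smooth_continuous _ _ (fun x : 'rV[R]_n => dotv x x)).
  by apply: smooth_sum => i _; apply: smoothM; exact: smooth_coord.
exact: sqrt_continuous.
Qed.

Lemma dotv_unit e : enorm e = 1 -> dotv e e = 1.
Proof.
rewrite /enorm => e1; rewrite -[LHS]sqr_sqrtr ?e1 ?expr1n//.
by apply: sumr_ge0 => i _; rewrite -expr2 sqr_ge0.
Qed.

Lemma enorm_sub_continuous (a : 'rV[R]_n) : continuous (fun y => enorm (y - a)).
Proof.
move=> x; apply: (@continuous_comp _ _ _ (fun y : 'rV[R]_n => y - a) (@enorm R n)).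
  apply: (@continuous_rVP _ _ _ (fun y : 'rV[R]_n => y - a)) => i.
  under eq_fun do rewrite !mxE.
  apply: (@smooth_continuous _ _ (fun y : 'rV[R]_n => y 0 i - a 0 i)).
  by apply: smoothB; [exact: smooth_coord|exact: smooth_cst].
exact: enorm_continuous.
Qed.

Lemma enorm_ball_near (a x : 'rV[R]_n) (r : R) : enorm (x - a) < r ->
  \forall y \near x, enorm (y - a) < r.
Proof.
move=> xr; have H := cvgr_lt _ (@enorm_sub_continuous a x); exact: (H _ _ xr).
Qed.

Lemma enorm_lipschitz_continuous (g : 'rV[R]_n -> R) (L : R) :
  (forall y z, `|g y - g z| <= L * enorm (y - z)) -> continuous g.
Proof.
move=> gL x; apply/(@cvgrPdist_le _ _ _ (nbhs x) (nbhs_filter x)) => eps eps0.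
have L0 : 0 < `|L| + 1 by rewrite ltr_wpDl.
have : enorm (x - x) < eps / (`|L| + 1) by rewrite subrr enorm0 divr_gt0.
move=> /enorm_ball_near; apply: filterS => y; rewrite ltr_pdivlMr// => H.
have e0 : 0 <= enorm (y - x) by exact: sqrtr_ge0.
rewrite distrC (le_trans (gL _ _))// (le_trans _ (ltW H))// mulrC.
by rewrite ler_wpM2l// (le_trans (ler_norm L))// lerDl.
Qed.

Lemma orth_part_continuous e : continuous (fun y : 'rV[R]_n => y - dotv y e *: e).
Proof.
apply: continuous_rVP => i; under eq_fun do rewrite !mxE.
apply: (@smooth_continuous _ _ (fun y : 'rV[R]_n => y 0 i - dotv y e * e 0 i)).
apply: smoothB; first exact: smooth_coord.
by apply: (smoothM (g := cst (e 0 i))); [exact: smooth_dotv|exact: smooth_cst].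
Qed.

(* At a boundary point x, moving along -e leaves the closed epigraph. *)
Lemma interior_closure_lipschitz (Omega : set 'rV[R]_n) :
  lipschitz_boundary Omega -> (closure Omega)° `<=` Omega.
Proof.
move=> lip x ix; apply: contrapT => nx.
have cx : closure Omega x by exact: interior_subset ix.
have [e [g [L [r [e1 r0 gL HO]]]]] := lip x (conj cx nx).
have cg := enorm_lipschitz_continuous gL.
have ce : continuous (fun y => dotv y e) by apply: smooth_continuous; exact: smooth_dotv.
(* [F] is the height above the graph in direction [e]: positive exactly on [Omega] near [x], and
   lowered by exactly [t] under a shift by [- t *: e], which keeps the orthogonal component. *)
pose F := (fun y => dotv y e) \- (fun y => g (y - dotv y e *: e)).
have cF : continuous F.
  have cge : continuous (fun y => g (y - dotv y e *: e)).
    move=> y; apply: (@continuous_comp _ _ _ (fun y => y - dotv y e *: e) g); last exact: cg.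
    exact: orth_part_continuous.
  by move=> y; apply: continuousB; [exact: ce|exact: cge].
have HF y : enorm (y - x) < r -> Omega y <-> 0 < F y.
  by move=> /HO ->; rewrite /F /= subr_gt0.
have Fx : F x <= 0.
  by rewrite leNgt; apply/negP => /HF; rewrite subrr enorm0 => /(_ r0).
have Ft t : F (x - t *: e) = F x - t.
  rewrite /F /= -scaleNr dotvDl dotvZl dotv_unit// mulr1.
  rewrite (_ : x + - t *: e - (dotv x e - t) *: e = x - dotv x e *: e); first by ring.
  by rewrite scalerBl scaleNr opprB addrA subrK.
have N : \forall y \near x, closure Omega y /\ enorm (y - x) < r.
  apply: filterI; first exact: ix.
  by apply: enorm_ball_near; rewrite subrr enorm0.
have ct : (fun t : R => x - t *: e) @ (0 : R) --> x.
  apply: (@cvg_rV R n _ (nbhs (0 : R)) (nbhs_filter (0 : R))) => i.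
  under eq_fun do rewrite !mxE.
  have : (fun t : R => x 0 i - t * e 0 i) @ (0 : R) --> x 0 i - 0 * e 0 i.
    apply: cvgB; first exact: cvg_cst.
    by apply: cvgM; [exact: cvg_id|exact: cvg_cst].
  by rewrite mul0r subr0.
have [t [t0 [ct1 ct2]]] : exists t : R, 0 < t /\
    (closure Omega (x - t *: e) /\ enorm (x - t *: e - x) < r).
  have /nbhs_ballP[d /= d0 Hd] := ct _ N.
  exists (d / 2); split; first by rewrite divr_gt0.
  apply: Hd; rewrite /ball /= sub0r normrN ger0_norm; last by rewrite divr_ge0// ltW.
  by rewrite ltr_pdivrMr// ltr_pMr// ltr1n.
(* The shifted point is still in the closure of [Omega], so [Omega] meets the neighbourhood where
   [F] is negative, a contradiction. *)
have F0 : F (x - t *: e) < 0 by rewrite Ft; lra.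
have [y [Oy [Fy ey]]] : Omega `&` [set y | F y < 0 /\ enorm (y - x) < r] !=set0.
  apply: ct1; apply: filterI; last exact: enorm_ball_near.
  by have H := cvgr_lt _ (cF (x - t *: e)); exact: (H _ _ F0).
by move: (HF y ey) => [/(_ Oy)]; rewrite ltNge (ltW Fy).
Qed.

End euclidean_theory.

Section H1_restriction.
Context (R : realType) (n : nat) (D E : set 'rV[R]_n).
Hypotheses (oD : open D) (oE : open E) (DE : D `<=` E).

Let mD : measurable D. Proof. exact: open_measurable_rV. Qed.
Let mE : measurable E. Proof. exact: open_measurable_rV. Qed.

Lemma test_fun_eq0 (z : 'rV[R]_n -> R) x : test_fun D z -> ~ D x ->
  z x = 0 /\ forall i, pderiv i z x = 0.
Proof.
move=> [_ _ supp] nDx.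
have : \forall y \near x, (~` closure [set x | z x != 0]) y.
  apply: open_nbhs_nbhs; split; first exact/closed_openC/closed_closure.
  by move=> /supp.
have nz y : (~` closure [set x | z x != 0]) y -> z y = 0.
  move=> ny; apply/eqP; apply: contrapT => /negP zy; apply: ny.
  exact: subset_closure.
move=> H; split; first by apply: nz; exact: nbhs_singleton H.
by move=> i; apply: near_eq0_derive; exact: filterS H.
Qed.

Lemma ip_restrict (v z : 'rV[R]_n -> R) : (forall x, ~ D x -> z x = 0) ->
  ip D v z = ip E v z.
Proof.
move=> z0; rewrite /ip -[in LHS](setIidr DE) Rintegral_mkcondr.
apply: eq_Rintegral => x _; rewrite patchE; case: ifPn => // /negP.
by rewrite inE => /z0 ->; rewrite mulr0.
Qed.

(** A test function of [D] is one of [E], and it vanishes off [D] with its derivatives, so the same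
    integrals over [D] and [E] agree. *)
Lemma H1_restrict (v : 'rV[R]_n -> R) : H1 E v -> H1 D v.
Proof.
move=> [Lv [g [Lg Hg]]]; split; first exact: (L2S mE mD DE Lv).
exists g; split=> [i|z tz i]; first exact: (L2S mE mD DE (Lg i)).
rewrite !ip_restrict.
- apply: Hg; case: tz => sz cz supp; split => //; exact: subset_trans DE.
- by move=> x /(test_fun_eq0 tz)[].
- by move=> x /(test_fun_eq0 tz)[_]; exact.
Qed.

End H1_restriction.

Section broken_polynomials.
Context (R : realType) (n : nat) (M : mesh R n) (Omega : set 'rV[R]_n).
Hypotheses (oO : open Omega) (bO : bounded_set Omega)
  (lip : lipschitz_boundary Omega) (part : simplicial_partition M Omega).
Implicit Types v w : 'rV[R]_n -> R.

(** The partition only controls the closure of [Omega]. The Lipschitz boundary excludes slits, where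
    the interior of the closure would be larger than the domain. *)
Lemma cell_sub T : T \in cells M -> cell T `<=` Omega.
Proof.
move=> TM; apply: subset_trans (interior_closure_lipschitz lip).
apply: interiorS; case: part => _ -> _ x Tx; by exists T.
Qed.

Lemma cell_open (T : {set 'I_(mesh_size M)}) : open (cell T).
Proof. exact: open_interior. Qed.

Lemma bounded_set_sub (A B : set 'rV[R]_n) : A `<=` B -> bounded_set B -> bounded_set A.
Proof.
move=> AB [C [rC HC]]; exists C; split => // x Cx y /AB; exact: HC.
Qed.

Lemma cell_bounded T : T \in cells M -> bounded_set (cell T).
Proof. by move=> TM; exact: bounded_set_sub (cell_sub TM) bO. Qed.

(** The hulls cover [Omega], and on each of them the function agrees almost everywhere with a
    polynomial, which is bounded on the bounded set [Omega]. *)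
Lemma brokenP_Linfty p v : brokenP M Omega p v -> Linfty Omega v.
Proof.
move=> [mv Hv]; split => //.
have HT (T : {set 'I_(mesh_size M)}) : exists C, 0 <= C /\ (T \in cells M ->
    {ae leb R n, forall x, hull T x -> Omega x -> `|v x| <= C}).
  have [TM|nTM] := boolP (T \in cells M); last by exists 0.
  have [q /smooth_poly_fun sq vq] := Hv T TM.
  have [C HC] := continuous_bounded_rV (smooth_continuous sq) bO.
  exists `|C|; split => // _; move: vq; rewrite /ae_on; apply: filterS => x vq Tx Ox.
  by rewrite vq//; apply: le_trans (ler_norm C); exact: HC.
have [C HC] := choice HT.
(* All the constants are nonnegative, so the sum dominates each of them and replaces a maximum. *)
exists (\sum_T C T).
have : {ae leb R n, forall x, forall T : {set 'I_(mesh_size M)},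
    T \in cells M -> hull T x -> Omega x -> `|v x| <= C T}.
  apply: ae_forall_countable => T; have [_ H] := HC T.
  have [TM|nTM] := boolP (T \in cells M); first by apply: filterS (H TM) => x Hx _.
  by apply: aeW.
apply: filterS => x H Ox.
have [T /= TM Tx] : (\bigcup_(T in [set` cells M]) hull T) x.
  by case: part => _ <- _; exact: subset_closure.
apply: (le_trans (H T TM Tx Ox)); rewrite (bigD1 T)//= lerDl.
by apply: sumr_ge0 => T' _; have [] := HC T'.
Qed.

Lemma brokenP_L2 p v : brokenP M Omega p v -> L2 Omega v.
Proof.
move=> /brokenP_Linfty; apply: Linfty_L2; first exact: open_measurable_rV.
by apply: leb_bounded_lty => //; exact: open_measurable_rV.
Qed.

(** On a cell the function is almost everywhere a polynomial, whose classical gradient is its weak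
    gradient. *)
Lemma brokenP_H1 p v T : brokenP M Omega p v -> T \in cells M -> H1 (cell T) v.
Proof.
move=> [mv Hv] TM; have [q /smooth_poly_fun sq vq] := Hv T TM.
have mO : measurable Omega by exact: open_measurable_rV.
have oT : open (cell T) by exact: cell_open.
have bT : bounded_set (cell T) by exact: cell_bounded.
apply: (H1_ae (w := q)).
- exact: measurable_funS (cell_sub TM) mv.
- by apply: ae_on_sub vq; exact: interior_subset.
- by split; [exact: smooth_L2|exists (grad q); exact: is_wgrad_smooth].
Qed.

Lemma poly_fun_lin p (c : R) q1 q2 : @poly_fun R n p q1 -> poly_fun p q2 ->
  poly_fun p (fun x => c * q1 x + q2 x).
Proof.
move=> [c1 ->] [c2 ->]; exists (fun e => c * c1 e + c2 e); apply/funext => x.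
by rewrite mulr_sumr -big_split; apply: eq_bigr => e _; rewrite mulrDl mulrA.
Qed.

Lemma brokenP_lin p (c : R) v w : brokenP M Omega p v -> brokenP M Omega p w ->
  brokenP M Omega p (fun x => c * v x + w x).
Proof.
move=> [mv Hv] [mw Hw]; split.
  by apply: measurable_funD => //; exact: measurable_funM.
move=> T TM; have [q1 P1 E1] := Hv T TM; have [q2 P2 E2] := Hw T TM.
exists (fun x => c * q1 x + q2 x); first exact: poly_fun_lin.
by apply: ae_onS2 E1 E2 => x _ -> ->.
Qed.

Lemma H1_brokenH1 v : H1 Omega v -> brokenH1 M Omega v.
Proof.
move=> Hv; split; first by case: Hv.
by move=> T TM; apply: H1_restrict Hv => //; [exact: cell_open|exact: cell_sub].
Qed.

End broken_polynomials.

(** * Traces, jumps and the DG-norm *)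

Section ereal_lin2.
Context (R : realType).
Local Open Scope ereal_scope.

(** An infimum over an empty set of jumps is +oo, which makes the bound trivial; when both infima
    are finite, near-minimizers give it up to an arbitrary error. *)
Lemma ereal_inf_lin2 (T : Type) (P Q : set T) (g h : T -> R) (x : \bar R) :
  (forall s, P s -> (0 <= g s)%R) -> (forall t, Q t -> (0 <= h t)%R) ->
  (forall s t, P s -> Q t -> x <= (2 * g s + 2 * h t)%R%:E) ->
  x <= 2%:E * ereal_inf [set (g s)%:E | s in P] + 2%:E * ereal_inf [set (h t)%:E | t in Q].
Proof.
move=> g0 h0 H.
have J1 : 0 <= ereal_inf [set (g s)%:E | s in P].
  by apply: le_ereal_inf_tmp => _ [s Ps <-]; rewrite lee_fin g0.
have J2 : 0 <= ereal_inf [set (h t)%:E | t in Q].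
  by apply: le_ereal_inf_tmp => _ [t Qt <-]; rewrite lee_fin h0.
have inf2 (y : \bar R) : 0 <= y -> y = +oo \/ y \is a fin_num.
  by case: y => [r _|_|//]; [right|left].
have [e1|F1] := inf2 _ J1.
  rewrite e1 gt0_muley ?lte_fin// addye ?leey//.
  by rewrite -ltNye (lt_le_trans (ltNyr 0) (mule_ge0 _ J2)).
have [e2|F2] := inf2 _ J2.
  rewrite e2 gt0_muley ?lte_fin// addey ?leey//.
  by rewrite -ltNye (lt_le_trans (ltNyr 0) (mule_ge0 _ J1)).
apply/lee_addgt0Pr => e e0.
(* Both infima carry the factor 2, so errors of [e / 4] add up to [e]. *)
have e4 : (0 < e / 4)%R by rewrite divr_gt0.
have [_ [s Ps <-] l1] := lb_ereal_inf_adherent e4 F1.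
have [_ [t Qt <-] l2] := lb_ereal_inf_adherent e4 F2.
apply: (le_trans (H s t Ps Qt)); move: l1 l2.
rewrite -(fineK F1) -(fineK F2) -!EFinM -!EFinD !lte_fin lee_fin.
by move: (fine _) (fine _) => a b; lra.
Qed.

Lemma lee_sum_lin2 (I : finType) (P : pred I) (a b c : I -> \bar R) :
  (forall i, 0 <= b i) -> (forall i, 0 <= c i) ->
  (forall i, P i -> a i <= 2%:E * b i + 2%:E * c i) ->
  \sum_(i | P i) a i <= 2%:E * (\sum_(i | P i) b i) + 2%:E * (\sum_(i | P i) c i).
Proof.
move=> b0 c0 H; rewrite !ge0_sume_distrr// -big_split.
exact: lee_sum.
Qed.

Lemma leeD_lin2 (a b c d e f : \bar R) : 0 <= b -> 0 <= c -> 0 <= e -> 0 <= f ->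
  a <= 2%:E * b + 2%:E * c -> d <= 2%:E * e + 2%:E * f ->
  a + d <= 2%:E * (b + e) + 2%:E * (c + f).
Proof.
by move=> b0 c0 e0 f0 H1 H2; rewrite !ge0_muleDr// addeACA; exact: leeD.
Qed.

Lemma lee_mul_lin2 (k : R) (a b c : \bar R) : (0 <= k)%R -> 0 <= b -> 0 <= c ->
  a <= 2%:E * b + 2%:E * c -> k%:E * a <= 2%:E * (k%:E * b) + 2%:E * (k%:E * c).
Proof.
move=> k0 b0 c0 H; rewrite !(muleCA 2%:E) -ge0_muleDr ?mule_ge0 ?lee_fin//.
by apply: lee_wpmul2l => //; rewrite lee_fin.
Qed.

Lemma lee_lin2_eq (a a' b b' c c' : \bar R) : a = a' -> b = b' -> c = c' ->
  a' <= 2%:E * b' + 2%:E * c' -> a <= 2%:E * b + 2%:E * c.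
Proof. by move=> -> -> ->. Qed.

End ereal_lin2.

Section facets.
Context (R : realType) (n : nat) (M : mesh R n).
Local Notation I := 'I_(mesh_size M).
Implicit Types (F T : {set I}) (v t : 'rV[R]_n -> R).

Lemma smooth_facet_param F i : smooth (fun s => facet_param F s 0 i).
Proof.
rewrite (_ : (fun s => _) = fun s : 'rV[R]_n.-1 => nth 0 (facet_verts F) 0%N 0 i +
    \sum_j s 0 j * facet_edges F j i); last first.
  by apply/funext => s; rewrite /facet_param !mxE.
apply: (smoothD (f := cst (nth 0 (facet_verts F) 0%N 0 i))).
  exact: smooth_cst.
apply: smooth_sum => j _; apply: (smoothM (g := cst (facet_edges F j i))).
  exact: smooth_coord.
exact: smooth_cst.
Qed.

Lemma facet_param_continuous F : continuous (facet_param F).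
Proof. by apply: continuous_rVP => i; apply: smooth_continuous; exact: smooth_facet_param. Qed.

Lemma measurable_ref_simplex k : measurable (@ref_simplex R k).
Proof.
rewrite (_ : @ref_simplex R k = [set s : 'rV[R]_k | forall i, `[0, +oo[%classic (s 0 i)] `&`
    ((fun s : 'rV[R]_k => \sum_i s 0 i) @^-1` `]-oo, 1]%classic)); last first.
  apply/seteqP; split => s /= [H1 H2]; rewrite ?in_itv /= in H2 *; split => // i;
    by have := H1 i; rewrite ?in_itv /= ?andbT.
apply: measurableI.
  by apply: (@measurable_coordwise _ _ (fun=> `[0, +oo[%classic)) => i; exact: measurable_itv.
rewrite -[X in measurable X]setTI.
have /continuous_measurable_rV mf : continuous (fun s : 'rV[R]_k => \sum_i s 0 i).
  by apply: smooth_continuous; apply: smooth_sum => i _; exact: smooth_coord.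
by apply: mf => //; exact: measurable_itv.
Qed.

Lemma bounded_ref_simplex k : bounded_set (@ref_simplex R k).
Proof.
exists 1; split => // C C1 s [s0 s1] /=; apply: le_trans (ltW C1).
apply: norm_le_coord => // i; rewrite ger0_norm//; apply: le_trans s1.
by rewrite (bigD1 i)//= lerDl; apply: sumr_ge0.
Qed.

Lemma continuous_facet_L2 F t : continuous t -> facet_L2 F t.
Proof.
move=> ct; have mS := @measurable_ref_simplex n.-1.
have bS := @bounded_ref_simplex n.-1.
apply: Linfty_L2 => //; first exact: leb_bounded_lty.
apply: Linfty_continuous => // s.
apply: (@continuous_comp _ _ _ (facet_param F) t); last exact: ct.
exact: facet_param_continuous.
Qed.

Lemma facet_intE F t : facet_int F (fun x => t x ^+ 2) =
  Num.sqrt (\det (facet_edges F *m (facet_edges F)^T)) *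
  ip (@ref_simplex R n.-1) (t \o facet_param F) (t \o facet_param F).
Proof. by []. Qed.

Lemma facet_int_ge0 F t : 0 <= facet_int F (fun x => t x ^+ 2).
Proof. by rewrite facet_intE mulr_ge0 ?sqrtr_ge0// ip_ge0. Qed.

Lemma facet_L2B F s t : facet_L2 F s -> facet_L2 F t -> facet_L2 F (s \- t).
Proof. exact: (L2B (@measurable_ref_simplex n.-1)). Qed.

Lemma facet_int_sub_le F s t : facet_L2 F s -> facet_L2 F t ->
  facet_int F (fun x => (s \- t) x ^+ 2) <=
  2 * facet_int F (fun x => s x ^+ 2) + 2 * facet_int F (fun x => t x ^+ 2).
Proof.
move=> Ls Lt; have H := ip_sub_le (@measurable_ref_simplex n.-1) Ls Lt.
have k0 := sqrtr_ge0 (\det (facet_edges F *m (facet_edges F)^T)).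
rewrite !facet_intE mulrCA [2 * (_ * _)]mulrCA -mulrDr.
by apply: ler_wpM2l.
Qed.

Lemma facet_int_distr F s t : facet_int F (fun x => (s \- t) x ^+ 2) =
  facet_int F (fun x => (t \- s) x ^+ 2).
Proof.
by congr facet_int; apply/funext => x /=; rewrite -sqrrN opprB.
Qed.

Lemma cvg0_lin2 (a b c : nat -> R) : (forall j, 0 <= a j) ->
  (forall j, a j <= 2 * b j + 2 * c j) ->
  b @ \oo --> 0 -> c @ \oo --> 0 -> a @ \oo --> 0.
Proof.
move=> a0 abc b0 c0.
have bc0 : (fun j => 2 * b j + 2 * c j) @ \oo --> (0 : R).
  rewrite [X in _ --> X](_ : 0 = 2 * 0 + 2 * 0 :> R); last by rewrite mulr0 addr0.
  by apply: cvgD; apply: cvgM => //; exact: cvg_cst.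
apply: (squeeze_cvgr (f := cst 0) _ _ bc0); last exact: cvg_cst.
by apply: nearW => j; rewrite /= a0 abc.
Qed.

(** Differences of approximating sequences approximate the difference. The factor 2 lost in both
    squared distances does not matter, since they tend to 0. *)
Lemma is_trace_sub T F v1 v2 v t1 t2 : bounded_set (cell T) ->
  H1 (cell T) v1 -> H1 (cell T) v2 -> ae_on (cell T) (fun x => v x = v1 x - v2 x) ->
  is_trace T F v1 t1 -> is_trace T F v2 t2 -> is_trace T F v (t1 \- t2).
Proof.
move=> bT Hv1 Hv2 vE [L1 [z1 [s1 d1 f1]]] [L2 [z2 [s2 d2 f2]]].
have oT : open (cell T) by exact: open_interior.
split; first exact: facet_L2B.
exists (fun j => z1 j \- z2 j); split=> [j||]; first exact: smoothB.
- apply: cvg0_lin2 d1 d2 => j; first exact: H1dist_sqr_ge0.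
  rewrite (H1dist_sqr_ae oT bT _ (w := v1 \- v2))//.
  exact: H1dist_sqr_sub_le.
- apply: cvg0_lin2 f1 f2 => j.
    by rewrite (facet_int_ge0 F (fun x => (z1 j \- z2 j) x - (t1 \- t2) x)).
  rewrite (_ : (fun x => _) = fun x => ((z1 j \- t1) \- (z2 j \- t2)) x ^+ 2); last first.
    by apply/funext => x /=; congr (_ ^+ 2); ring.
  apply: facet_int_sub_le; apply: facet_L2B => //;
    by apply: continuous_facet_L2; exact: smooth_continuous.
Qed.

(* On an interior facet the two jumps may be taken with opposite orientations. *)
Lemma is_jump_sub F v1 v2 v t1 t2 :
  (forall T, T \in cells M -> [/\ bounded_set (cell T), H1 (cell T) v1, H1 (cell T) v2 &
     ae_on (cell T) (fun x => v x = v1 x - v2 x)]) ->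
  is_jump F v1 t1 -> is_jump F v2 t2 ->
  exists2 t, is_jump F v t & facet_int F (fun x => t x ^+ 2) <=
  2 * facet_int F (fun x => t1 x ^+ 2) + 2 * facet_int F (fun x => t2 x ^+ 2).
Proof.
move=> HT; rewrite /is_jump; case: ifPn => FI.
- move=> [T1 [T2 [a1 [a2 [c12 A1 A2 ->]]]]] [S1 [S2 [b1 [b2 [d12 B1 B2 ->]]]]].
  have T1M : T1 \in cells M.
    have : T1 \in cells_at F by rewrite c12 !inE eqxx.
    by rewrite inE => /andP[].
  have T2M : T2 \in cells M.
    have : T2 \in cells_at F by rewrite c12 !inE eqxx orbT.
    by rewrite inE => /andP[].
  have [bT1 H11 H12 E1] := HT _ T1M; have [bT2 H21 H22 E2] := HT _ T2M.
  have T12 : T1 != T2.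
    by move: FI; rewrite inE c12 cards2 => /andP[_]; case: (T1 != T2).
  have LA1 : facet_L2 F a1 by case: A1.
  have LA2 : facet_L2 F a2 by case: A2.
  have LB1 : facet_L2 F b1 by case: B1.
  have LB2 : facet_L2 F b2 by case: B2.
  (* Both orientations are treated at once: [b] and [b'] are the traces of [v2] relisted in the
     order [T1], [T2], at the price of a sign that the square ignores. *)
  have main (b b' : 'rV[R]_n -> R) : is_trace T1 F v2 b -> is_trace T2 F v2 b' ->
      facet_int F (fun x => (b1 \- b2) x ^+ 2) = facet_int F (fun x => (b \- b') x ^+ 2) ->
      exists2 t, (exists T3 T4 t3 t4, [/\ cells_at F = [set T3; T4]%SET,
         is_trace T3 F v t3, is_trace T4 F v t4 & t = t3 \- t4]) &
      facet_int F (fun x => t x ^+ 2) <= 2 * facet_int F (fun x => (a1 \- a2) x ^+ 2)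
        + 2 * facet_int F (fun x => (b1 \- b2) x ^+ 2).
    move=> Tb Tb' ->.
    have Lb : facet_L2 F b by case: Tb.
    have Lb' : facet_L2 F b' by case: Tb'.
    exists ((a1 \- b) \- (a2 \- b')).
      exists T1, T2, (a1 \- b), (a2 \- b'); split => //.
        exact: is_trace_sub A1 Tb.
      exact: is_trace_sub A2 Tb'.
    rewrite (_ : (a1 \- b) \- (a2 \- b') = (a1 \- a2) \- (b \- b')).
      by apply: facet_int_sub_le; exact: facet_L2B.
    by apply/funext => x /=; ring.
  have : S1 \in [set T1; T2]%SET by rewrite -c12 d12 !inE eqxx.
  have : S2 \in [set T1; T2]%SET by rewrite -c12 d12 !inE eqxx orbT.
  have S12 : S1 != S2.
    by move: FI; rewrite inE d12 cards2 => /andP[_]; case: (S1 != S2).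
  rewrite !inE => /orP[]/eqP e2 /orP[]/eqP e1.
  + by move: S12; rewrite e1 e2 eqxx.
  + rewrite e1 in B1; rewrite e2 in B2.
    by apply: (main b2 b1) => //; exact: facet_int_distr.
  + by rewrite e1 in B1; rewrite e2 in B2; exact: (main b1 b2).
  + by move: S12; rewrite e1 e2 eqxx.
- move=> [T c A] [S d B].
  have TS : S = T.
    have : S \in [set T]%SET by rewrite -c d inE.
    by rewrite inE => /eqP.
  rewrite TS in B.
  have TM : T \in cells M.
    have : T \in cells_at F by rewrite c inE.
    by rewrite inE => /andP[].
  have [bT H11 H12 E1] := HT _ TM.
  exists (t1 \- t2); first by exists T => //; exact: is_trace_sub A B.
  by apply: facet_int_sub_le; [case: A|case: B].
Qed.

Lemma jump_sqr_ge0 F v : (0 <= jump_sqr F v)%E.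
Proof.
by apply: le_ereal_inf_tmp => _ [t _ <-]; rewrite lee_fin facet_int_ge0.
Qed.

Lemma jump_sqr_sub_le F v1 v2 v :
  (forall T, T \in cells M -> [/\ bounded_set (cell T), H1 (cell T) v1, H1 (cell T) v2 &
     ae_on (cell T) (fun x => v x = v1 x - v2 x)]) ->
  (jump_sqr F v <= 2%:E * jump_sqr F v1 + 2%:E * jump_sqr F v2)%E.
Proof.
move=> HT.
apply: (@ereal_inf_lin2 _ _ (is_jump F v1) (is_jump F v2)
  (fun t => facet_int F (fun x => t x ^+ 2)) (fun t => facet_int F (fun x => t x ^+ 2))).
- by move=> t _; exact: facet_int_ge0.
- by move=> t _; exact: facet_int_ge0.
- move=> t1 t2 j1 j2; have [t j le] := is_jump_sub HT j1 j2.
  apply: (@le_trans _ _ (facet_int F (fun x => t x ^+ 2))%:E).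
    by apply: ereal_inf_lbound; exists t.
  by rewrite lee_fin.
Qed.

End facets.

Lemma enorm_ge0 (R : realType) (n : nat) (x : 'rV[R]_n) : 0 <= enorm x.
Proof. exact: sqrtr_ge0. Qed.

Lemma diam_ge0 (R : realType) (n : nat) (A : set 'rV[R]_n) : 0 <= diam A.
Proof.
have H (S : set R) : (forall y, S y -> 0 <= y) -> 0 <= sup S.
  (* Without a supremum in the reals, [sup] takes the default value 0. *)
  move=> S0; have [hS|nS] := pselect (has_sup S); last by rewrite sup_out.
  have [[y Sy] ubS] := hS.
  by apply: (@le_trans _ _ y); [exact: S0|exact: ub_le_sup].
by apply: H => _ [x _ [z _ <-]]; exact: enorm_ge0.
Qed.

Section dgnorm_theory.
Context (R : realType) (n : nat) (M : mesh R n).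
Implicit Types v : 'rV[R]_n -> R.

Local Open Scope ereal_scope.

Let coef_ge0 (F : {set 'I_(mesh_size M)}) : 0 <= ((diam (hull F))^-1)%:E.
Proof. by rewrite lee_fin invr_ge0 diam_ge0. Qed.

Lemma dgnorm_sqrE v : dgnorm M v ^+ 2 = \sum_(T in cells M) (adir (cell T) v v)%:E +
  \sum_(F in int_facets M :|: bdry_facets M) ((diam (hull F))^-1)%:E * jump_sqr F v.
Proof.
rewrite /dgnorm sqr_sqrte//; apply: adde_ge0; apply: sume_ge0 => i _.
  by rewrite lee_fin adir_ge0.
by rewrite mule_ge0 ?jump_sqr_ge0.
Qed.

Lemma dgnorm_ge0 v : 0 <= dgnorm M v.
Proof. exact: sqrte_ge0. Qed.

Lemma dgnorm_sub_le v1 v2 v :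
  (forall T, T \in cells M -> [/\ bounded_set (cell T), H1 (cell T) v1, H1 (cell T) v2 &
     ae_on (cell T) (fun x => (v x = v1 x - v2 x)%R)]) ->
  dgnorm M v ^+ 2 <= 2%:E * dgnorm M v1 ^+ 2 + 2%:E * dgnorm M v2 ^+ 2.
Proof.
move=> HT; apply: (lee_lin2_eq (dgnorm_sqrE v) (dgnorm_sqrE v1) (dgnorm_sqrE v2)).
have A0 w : 0 <= \sum_(T in cells M) (adir (cell T) w w)%:E.
  by apply: sume_ge0 => T _; rewrite lee_fin adir_ge0.
have B0 w : 0 <= \sum_(F in int_facets M :|: bdry_facets M)
    ((diam (hull F))^-1)%:E * jump_sqr F w.
  by apply: sume_ge0 => F _; rewrite mule_ge0 ?jump_sqr_ge0.
apply: leeD_lin2 => //.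
  apply: lee_sum_lin2 => [T|T|T TM]; rewrite ?lee_fin ?adir_ge0//.
  have [bT H1v1 H1v2 vE] := HT T TM.
  have oT : open (cell T) by exact: open_interior.
  have K := adir_sub_le oT bT H1v1 H1v2 vE.
  exact: K.
apply: lee_sum_lin2 => [F|F|F _].
- by apply: mule_ge0; [exact: coef_ge0|exact: jump_sqr_ge0].
- by apply: mule_ge0; [exact: coef_ge0|exact: jump_sqr_ge0].
- apply: lee_mul_lin2; [by rewrite invr_ge0 diam_ge0|exact: jump_sqr_ge0|exact: jump_sqr_ge0|].
  exact: jump_sqr_sub_le.
Qed.

End dgnorm_theory.

(** * Bregman divergences *)

Section bregman_theory.
Context (R : realType).

(** It samples a property valid near 0 at an increment [t * d] with 0 < t < 1, the increments about
    which convexity on a segment of direction [d] says something. *)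
Lemma dnbhs0_scale (P : R -> Prop) (d : R) : d != 0 -> (\forall h \near 0^', P h) ->
  exists t, [/\ 0 < t, t < 1 & P (t * d)].
Proof.
move=> d0 /nbhs_ballP[e /= e0 He].
have nd0 : 0 < `|d| by rewrite normr_gt0.
(* The first bound gives [t < 1]; the second gives t |d| <= e/2, inside the ball. *)
pose t := Num.min (2^-1) (e / (2 * `|d|)).
have t0 : 0 < t by rewrite lt_min invr_gt0 ltr0n/= divr_gt0// mulr_gt0.
have t1 : t <= 2^-1 by rewrite ge_min lexx.
have t2 : t * (2 * `|d|) <= e by rewrite -ler_pdivlMr ?mulr_gt0// ge_min lexx orbT.
exists t; split => //; first by lra.
apply: He; last by rewrite mulf_neq0// gt_eqF.
rewrite /ball /= sub0r normrN normrM (gtr0_norm t0).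
have := mulr_gt0 t0 nd0; lra.
Qed.

Lemma legendre_fin (b : R) (r : R -> \bar R) y : legendre b r -> b <= y ->
  r y = (fine (r y))%:E.
Proof.
move=> Lr /(legendre_dom Lr) ry; rewrite fineK// fin_numElt ry andbT.
by rewrite ltNye; exact: legendre_gtNy Lr y.
Qed.

(** If the tangent inequality failed, the limit of the difference quotients would lie strictly on
    the wrong side of the chord slope, and so would some quotient at [t * d], against convexity. The
    point [v] is interior, where the derivative exists; [w] may be the endpoint [b]. *)
Lemma legendre_tangent (b : R) (r : R -> \bar R) (v w : R) :
  legendre b r -> b < v -> b <= w ->
  fine (r v) + derive1 (fine \o r) v * (w - v) <= fine (r w).
Proof.
move=> Lr bv bw; set f := fine \o r.
have [->|vw] := eqVneq v w; first by rewrite subrr mulr0 addr0.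
pose d := w - v; have d0 : d != 0 by rewrite subr_eq0 eq_sym.
have conv t : 0 < t -> t < 1 -> f (t * d + v) - f v <= t * (f w - f v).
  move=> t0 t1; have wv : w != v by rewrite eq_sym.
  have := legendre_strict_convex Lr bw (ltW bv) wv t0 t1.
  rewrite (_ : t * w + (1 - t) * v = t * d + v); last by rewrite /d; ring.
  have bt : b <= t * d + v.
    rewrite /d (_ : _ + v = t * w + (1 - t) * v); last by ring.
    have H1 : t * b <= t * w by rewrite ler_pM2l.
    have H2 : (1 - t) * b <= (1 - t) * v by rewrite ler_wpM2l ?(ltW bv)//; lra.
    lra.
  rewrite (legendre_fin Lr bt) (legendre_fin Lr bw) (legendre_fin Lr (ltW bv)).
  rewrite -!EFinM -EFinD lte_fin /f /=.
  by move: (fine _) (fine _) (fine _) => x y z; lra.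
have cvg := @legendre_derivable _ _ _ Lr v bv.
have lim : h^-1 *: ((f \o shift v) (h *: 1) - f v) @[h --> 0^'] --> derive1 f v.
  by rewrite derive1E; exact: cvg.
rewrite -/d -[fine (r v)]/(f v) -[fine (r w)]/(f w).
have [dp|dn|d00] := ltgtP 0 d; last by rewrite -d00 eqxx in d0.
- rewrite leNgt; apply/negP => H.
  have Hs : (f w - f v) / d < derive1 f v by rewrite ltr_pdivrMr// ltrBlDl.
  have K := cvgr_gt _ lim.
  have [t [t0 t1]] := dnbhs0_scale d0 (K _ _ Hs); apply/negP; rewrite -leNgt.
  rewrite /= /GRing.scale /= mulr1 ler_pdivlMr// mulrC mulrA.
  rewrite (_ : d * (t * d)^-1 = t^-1); last by field; rewrite d0 gt_eqF.
  by rewrite ler_pdivrMl//; exact: conv.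
(* For negative [d], division reverses the inequalities and the quotients are compared from the
   other side. *)
- rewrite leNgt; apply/negP => H.
  have Hs : derive1 f v < (f w - f v) / d by rewrite ltr_ndivlMr// ltrBlDl.
  have K := cvgr_lt _ lim.
  have [t [t0 t1]] := dnbhs0_scale d0 (K _ _ Hs); apply/negP; rewrite -leNgt.
  rewrite /= /GRing.scale /= mulr1 ler_ndivrMr// mulrC mulrA.
  rewrite (_ : d * (t * d)^-1 = t^-1); last by field; rewrite d0 gt_eqF.
  by rewrite ler_pdivrMl//; exact: conv.
Qed.

(** The gap in the last inequality is the divergence of [v'] from [v], nonnegative by the tangent
    inequality [T3]. *)
Lemma bregman_three_points (b u v v' s s' : R) (r : R -> \bar R) :
  legendre b r -> b <= u -> b < v -> b < v' ->
  derive1 (fine \o r) v = s -> derive1 (fine \o r) v' = s' ->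
  [/\ (0 <= r u - r v' - (s' * (u - v'))%:E)%E, (0 <= r u - r v - (s * (u - v))%:E)%E &
    (r u - r v' - (s' * (u - v'))%:E + ((s' - s) * (u - v'))%:E <=
     r u - r v - (s * (u - v))%:E)%E].
Proof.
move=> Lr bu bv bv' d1 d2.
have T1 := legendre_tangent Lr bv bu.
have T2 := legendre_tangent Lr bv' bu.
have T3 := legendre_tangent Lr bv (ltW bv').
rewrite (legendre_fin Lr bu) (legendre_fin Lr (ltW bv)) (legendre_fin Lr (ltW bv')).
rewrite -!EFinB -!EFinD !lee_fin; rewrite d1 in T1 T3; rewrite d2 in T2.
move: T1 T2 T3; move: (fine _) (fine _) (fine _) => a c e T1 T2 T3.
by split; lra.
Qed.

End bregman_theory.

Section bregman_integrals.
Context (R : realType) (n : nat) (Omega : set 'rV[R]_n) (phi : 'rV[R]_n -> R)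
  (Rf : 'rV[R]_n -> R -> \bar R).
Hypotheses (mO : measurable Omega) (fO : (leb R n Omega < +oo)%E).
Hypotheses (HR : legendre_integrand Omega phi Rf) (HC : conjugate_facts Omega phi Rf).
Implicit Types u psi : 'rV[R]_n -> R.

(** The derivative of R at [dRs Rf psi] is [psi], by the inverse relation; it applies because these
    values lie strictly above [phi]. *)
Lemma bregman_pointwise u psi psi' : Linfty Omega psi -> Linfty Omega psi' ->
  ae_on Omega (fun x => phi x <= u x) ->
  ae_on Omega (fun x => [/\ (0 <= bregman Rf u (dRs Rf psi') x)%E,
    (0 <= bregman Rf u (dRs Rf psi) x)%E &
    (bregman Rf u (dRs Rf psi') x + ((psi' \- psi) x * (u \- dRs Rf psi') x)%:E <=
    bregman Rf u (dRs Rf psi) x)%E]).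
Proof.
move=> Lp Lp' phiu.
have [_ o1] := conj_map HC Lp; have [_ o2] := conj_map HC Lp'.
have := ae_onS2 (fun x _ a b => conj a b) (integrand_legendre HR) (conj_inverse HC).
have := ae_onS2 (fun x _ a b => conj a b) o1 o2.
move=> /(ae_onS2 (fun x _ a b => conj a b) phiu) H1 H2.
apply: ae_onS2 H1 H2 => x _ [ux [p1 p2]] [Lr inv].
have d1 : derive1 (fine \o Rf x) (dRs Rf psi x) = psi x by apply/(inv _ _ p1).
have d2 : derive1 (fine \o Rf x) (dRs Rf psi' x) = psi' x by apply/(inv _ _ p2).
by rewrite /bregman /dR d1 d2; exact: (bregman_three_points Lr ux p1 p2 d1 d2).
Qed.

Lemma bregman_int_ge0 u psi : Linfty Omega psi ->
  ae_on Omega (fun x => phi x <= u x) -> (0 <= bregman_int Omega Rf u (dRs Rf psi))%E.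
Proof.
move=> Lp phiu; have := bregman_pointwise Lp Lp phiu => H.
have := @ae_le_integralD _ _ _ (leb R n) Omega (fun=> 0%E) (bregman Rf u (dRs Rf psi)) (fun=> 0) mO.
rewrite integral0 adde0; apply; first exact: integrable0.
by apply: ae_onS H => x _ [h _ _]; split => //; rewrite adde0.
Qed.

Lemma bregman_int_step u psi psi' : Linfty Omega psi -> Linfty Omega psi' ->
  ae_on Omega (fun x => phi x <= u x) -> L2 Omega u ->
  (bregman_int Omega Rf u (dRs Rf psi') +
    (ip Omega (psi' \- psi) (u \- dRs Rf psi'))%:E <=
   bregman_int Omega Rf u (dRs Rf psi))%E.
Proof.
move=> Lp Lp' phiu Lu.
have L2p := Linfty_L2 mO fO Lp; have L2p' := Linfty_L2 mO fO Lp'.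
have [Lo' _] := conj_map HC Lp'.
have I := L2_mul mO (L2B mO L2p' L2p) (L2B mO Lu Lo').
have := ae_le_integralD mO I (bregman_pointwise Lp Lp' phiu).
by rewrite /ip /Rintegral fineK//; exact: integrable_fin_num.
Qed.

(** Strict monotonicity speaks of functions that differ on a non-null set; otherwise the second
    factor vanishes almost everywhere. *)
Lemma dRs_mono psi psi' : Linfty Omega psi -> Linfty Omega psi' ->
  0 <= ip Omega (dRs Rf psi \- dRs Rf psi') (psi \- psi').
Proof.
move=> Lp Lp'.
have [e|ne] := pselect (ae_on Omega (fun x => psi x = psi' x)).
  rewrite (@ip_ae _ _ _ _ (dRs Rf psi \- dRs Rf psi') _ (cst 0)).
  - rewrite /ip (_ : (fun x => _) = cst 0) ?Rintegral_cst// ?mul0r//.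
    by apply/funext => x /=; rewrite mulr0.
  - exact: ae_onW.
  - by apply: ae_onS e => x _ /= ->; rewrite subrr.
exact/ltW/(conj_strict_mono HC).
Qed.

End bregman_integrals.

Lemma dual_norm_le (R : realType) (V : normedModType R) (l : V -> R) (N : R) :
  (forall (c : R) v w, l (c *: v + w) = c * l v + l w) ->
  dual_norm l = N%:E -> forall v, `|l v| <= N * `|v|.
Proof.
move=> lin lN v.
have l0 : l 0 = 0.
  by have := lin 1 0 0; rewrite scale1r addr0 mul1r; lra.
have [->|v0] := eqVneq v 0; first by rewrite l0 !normr0 mulr0.
have nv : 0 < `|v| by rewrite normr_gt0.
have : (`|l (`|v|^-1 *: v)|%:E <= N%:E)%E.
  rewrite -lN; apply: ereal_sup_ubound; exists (`|v|^-1 *: v) => //=.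
  by rewrite normrZ normfV normr_id mulVf// gt_eqF.
have := lin (`|v|^-1) v 0; rewrite !addr0 l0 addr0 => ->.
by rewrite lee_fin normrM normfV normr_id mulrC ler_pdivrMr.
Qed.

Lemma dual_norm_ge0 (R : realType) (V : normedModType R) (l : V -> R) :
  (0 <= dual_norm l)%E.
Proof.
apply: (@le_trans _ _ `|l 0|%:E); first by rewrite lee_fin.
by apply: ereal_sup_ubound; exists 0 => //=; rewrite normr0.
Qed.

(** * The discrete problem *)

Section conforming_operator.
Context (R : realType) (n : nat) (Omega : set 'rV[R]_n) (V : normedModType R)
  (p : V -> 'rV[R]_n -> R) (Ch : ('rV[R]_n -> R) -> 'rV[R]_n -> R).
Hypotheses (oO : open Omega) (bO : bounded_set Omega).
Hypothesis p_linear : forall (c : R) v w,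
  ae_on Omega (fun x => p (c *: v + w) x = c * p v x + p w x).
Hypothesis p_L2 : forall v, L2 Omega (p v).
Hypothesis Ch_H1 : forall v, L2 Omega v -> H1 Omega (Ch v).
Hypothesis Ch_linear : forall (c : R) v w, L2 Omega v -> L2 Omega w ->
  ae_on Omega (fun x => Ch (fun y => c * v y + w y) x = c * Ch v x + Ch w x).
Hypothesis Ch_bounded : exists C : R, forall v, L2 Omega v ->
  H1sqr Omega (Ch v) <= C * ip Omega v v.

Let mO : measurable Omega. Proof. exact: open_measurable_rV. Qed.

(** [Ch] acts on representatives, and its boundedness in the L^2-norm is what makes it blind to null
    sets. *)
Lemma Ch_ae0 v : L2 Omega v -> ae_on Omega (fun x => v x = 0) ->
  ae_on Omega (fun x => Ch v x = 0).
Proof.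
move=> Lv v0; have [C HC] := Ch_bounded.
have ip0 : ip Omega v v = 0.
  have v0' : ae_on Omega (fun x => v x = (cst 0 : 'rV[R]_n -> R) x) by [].
  rewrite (ip_ae v0' v0') /ip (_ : (fun x => _) = cst 0) ?Rintegral_cst// ?mul0r//.
  by apply/funext => x /=; rewrite mulr0.
have [LC _] := Ch_H1 Lv.
apply: (L2_ip_eq0 mO LC); apply/eqP; rewrite eq_le ip_ge0 andbT.
have := HC v Lv; rewrite ip0 mulr0 /H1sqr.
by have := adir_ge0 Omega (Ch v); move: (adir _ _ _) (ip _ _ _) => a b; lra.
Qed.

Lemma Ch_p_linear (c : R) v w :
  ae_on Omega (fun x => Ch (p (c *: v + w)) x = c * Ch (p v) x + Ch (p w) x).
Proof.
pose g x := c * p v x + p w x; pose d := p (c *: v + w) \- g.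
have Lg : L2 Omega g by exact: L2_lin.
have Ld : L2 Omega d by exact: L2B.
have d0 : ae_on Omega (fun x => d x = 0).
  by apply: ae_onS (p_linear c v w) => x _; rewrite /d /g /= => ->; rewrite subrr.
(* An equality of functions, not only almost everywhere: the defect [d] becomes an explicit summand
   to which the linearity of [Ch] applies. *)
have E : p (c *: v + w) = fun x => 1 * d x + g x.
  by apply/funext => x; rewrite /d mul1r /= subrK.
have H := Ch_linear 1 Ld Lg; rewrite -E in H.
apply: ae_onS2 (Ch_ae0 Ld d0) (ae_onS2 (fun x _ a b => conj a b) H (Ch_linear c (p_L2 v) (p_L2 w))).
by move=> x _ e0 [-> ->]; rewrite e0 mulr0 add0r.
Qed.

Lemma adir_Ch_linear u (c : R) v w : H1 Omega u ->
  adir Omega u (Ch (p (c *: v + w))) =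
  c * adir Omega u (Ch (p v)) + adir Omega u (Ch (p w)).
Proof.
move=> Hu; apply: (adir_linr oO bO Hu) (Ch_p_linear c v w); exact: Ch_H1.
Qed.

End conforming_operator.

Section symmetric_bilinear_theory.
Context (R : realType) (V : normedModType R) (a : V -> V -> R).
Hypothesis ab : symmetric_bilinear a.

Lemma sbil_lin (c : R) v w z : a (c *: v + w) z = c * a v z + a w z.
Proof. by case: ab. Qed.

Lemma sbilC v w : a v w = a w v. Proof. by case: ab. Qed.

Lemma sbil_sqr v w : a (-1 *: w + v) (-1 *: w + v) = a v v - 2 * a v w + a w w.
Proof.
rewrite sbil_lin (sbilC w) (sbilC v) !sbil_lin (sbilC w v).
by move: (a w w) (a v v) (a v w) => x y z; ring.
Qed.

End symmetric_bilinear_theory.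

(** * Energy decay along the iterates and telescoping of the divergences *)

Section iterates.
Context (R : realType) (n : nat) (Omega : set 'rV[R]_n).
Context (f u : 'rV[R]_n -> R) (V : normedModType R) (p : V -> 'rV[R]_n -> R)
  (a : V -> V -> R) (U : V) (alpha : nat -> R) (uh : nat -> V)
  (psi o : nat -> 'rV[R]_n -> R) (B : nat -> \bar R).
Hypotheses (mO : measurable Omega) (ab : symmetric_bilinear a)
  (a_ge0 : forall v, 0 <= a v v)
  (psi_L2 : forall k, L2 Omega (psi k)) (o_L2 : forall k, L2 Omega (o k))
  (u_L2 : L2 Omega u) (alpha_gt0 : forall k, (1 <= k)%N -> 0 < alpha k).
Hypothesis iter1 : forall k, (1 <= k)%N -> forall v,
  a (uh k) v + (alpha k)^-1 * ip Omega (p v) (psi k \- psi k.-1) = ip Omega f (p v).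
Hypothesis iter2 : forall k j, (1 <= k)%N -> (1 <= j)%N ->
  ip Omega (p (uh k)) (psi j \- psi j.-1) = ip Omega (o k) (psi j \- psi j.-1).
Hypothesis orth : forall k, (1 <= k)%N ->
  ip Omega (p U) (psi k \- psi k.-1) = ip Omega u (psi k \- psi k.-1).
Hypothesis o_mono : forall k, (1 <= k)%N ->
  0 <= ip Omega (o k \- o k.-1) (psi k \- psi k.-1).
Hypothesis B_step : forall k, (1 <= k)%N ->
  (B k + (ip Omega (psi k \- psi k.-1) (u \- o k))%:E <= B k.-1)%E.

Definition energy v : R := 2^-1 * a v v - ip Omega f (p v).

Let psiB k : L2 Omega (psi k \- psi k.-1). Proof. exact: L2B. Qed.

(** The k-th equation tested with both iterates shows that the drop in energy is half the a-square
    of the increment plus a monotonicity term divided by [alpha k]. It starts at k = 2 because [o 0]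
    is tied to no discrete solution. *)
Lemma energy_nonincreasing k : (1 < k)%N -> energy (uh k) <= energy (uh k.-1).
Proof.
move=> k1; have k0 : (1 <= k)%N by exact: ltnW.
have k1' : (1 <= k.-1)%N by rewrite -ltnS prednK.
have E1 := iter1 k0 (uh k); have E2 := iter1 k0 (uh k.-1).
rewrite iter2// in E1; rewrite iter2// in E2.
have := o_mono k0; rewrite ipBl//.
have := a_ge0 (-1 *: uh k.-1 + uh k); rewrite (sbil_sqr ab).
have al : 0 < (alpha k)^-1 by rewrite invr_gt0 alpha_gt0.
rewrite /energy -E1 -E2.
move: (ip Omega (o k) _) (ip Omega (o k.-1) _) => x y.
move: (a _ (uh k)) (a (uh k) (uh k.-1)) (a (uh k.-1) _) => b c d.
move: (alpha k)^-1 al => s s0 H1 H2.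
have := mulr_ge0 (ltW s0) H2.
by rewrite mulrBr; move: (s * x) (s * y) => *; lra.
Qed.

Lemma energy_le k m : (1 <= k)%N -> (k <= m)%N -> energy (uh m) <= energy (uh k).
Proof.
move=> k1; elim: m => [|m IH]; first by case: k k1.
rewrite leq_eqVlt => /predU1P[->//|]; rewrite ltnS => km.
apply: le_trans (IH km); apply: (@energy_nonincreasing m.+1).
by rewrite ltnS (leq_trans k1).
Qed.

(** By the k-th equation, the two sides differ by [alpha k] times half the a-square of
    [uh k - U]. *)
Lemma energy_gap_le k : (1 <= k)%N ->
  alpha k * (energy (uh k) - energy U) <= ip Omega (psi k \- psi k.-1) (u \- o k).
Proof.
move=> k1; have E1 := iter1 k1 (uh k); have E2 := iter1 k1 U.
rewrite iter2// in E1; rewrite orth// in E2.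
have al := alpha_gt0 k1.
rewrite (ipC _ _ (u \- o k)) ipBl//.
have := a_ge0 (-1 *: U + uh k); rewrite (sbil_sqr ab).
rewrite /energy -E1 -E2.
move: (ip Omega (o k) _) (ip Omega u _) => x y.
move: (a _ (uh k)) (a (uh k) U) (a U _) => b c d H.
have -> : alpha k * (2^-1 * b - (b + (alpha k)^-1 * x) - (2^-1 * d - (c + (alpha k)^-1 * y))) =
   y - x - alpha k * (2^-1 * (b - 2 * c + d)).
  by field; rewrite gt_eqF.
by rewrite gerBl; apply: mulr_ge0; [exact: ltW|apply: mulr_ge0].
Qed.

(** The final energy, the smallest one, replaces the energy of each step, so that a single factor
    comes out of the sum of the [alpha k]. *)
Lemma bregman_energy m j : (j <= m)%N ->
  (B j + ((\sum_(1 <= k < j.+1) alpha k) * (energy (uh m) - energy U))%R%:E <= B 0%N)%E.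
Proof.
elim: j => [|j IH] jm; first by rewrite big_geq// mul0r adde0.
apply: le_trans (IH (ltnW jm)); rewrite big_nat_recr//= mulrDl EFinD addeCA addeC.
rewrite leeD2r//; apply: le_trans (@B_step j.+1 isT).
rewrite leeD2l// lee_fin; apply: le_trans (@energy_gap_le j.+1 isT).
by rewrite ler_pM2l ?alpha_gt0// lerB// energy_le.
Qed.

End iterates.

(** Here [e2] is |e|, [G] the energy gap, [del] the value delta(e), and [q], [d] are the squared
    DG-norms of [u - J u] and of the error. After infinite values are removed, what remains is real
    arithmetic. *)
Lemma error_bound_arith (R : realType) (C Cp A e2 G del eK eh : R) (Nd Bm B0 d q : \bar R) :
  0 < C -> 0 < Cp -> 0 < A -> 0 <= e2 -> 0 <= eK -> 0 <= eh ->
  (0 <= Nd)%E -> (0 <= Bm)%E -> (0 <= B0)%E -> (0 <= q)%E ->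
  (Bm + (A * G)%:E <= B0)%E ->
  2^-1 * (C * e2 ^+ 2) + del - eK - eh <= G ->
  (forall N, Nd = N%:E -> `|del| <= N * e2) ->
  (d <= 2%:E * ((Cp * e2) ^+ 2)%:E + 2%:E * q)%E ->
  ((C / (8 * Cp ^+ 2))%:E * d + Bm * A^-1%:E <=
   B0 * A^-1%:E + C^-1%:E * Nd ^+ 2 + eK%:E + eh%:E + (C / (4 * Cp ^+ 2))%:E * q)%E.
Proof.
move=> C0 Cp0 A0 e0 eK0 eh0 N0 Bm0 B00 q0 HB HG Hdel Hd.
have Cp2 : 0 < Cp ^+ 2 by rewrite exprn_gt0.
have k8 : 0 < C / (8 * Cp ^+ 2) by rewrite divr_gt0// mulr_gt0.
have k4 : 0 < C / (4 * Cp ^+ 2) by rewrite divr_gt0// mulr_gt0.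
have iA : 0 < A^-1 by rewrite invr_gt0.
have ninf (x : \bar R) : (0 <= x)%E -> x != -oo%E by case: x.
have T1 : (0 <= B0 * A^-1%:E)%E by rewrite mule_ge0// lee_fin ltW.
have T2 : (0 <= C^-1%:E * Nd ^+ 2)%E by rewrite mule_ge0 ?expe_ge0// lee_fin ltW// invr_gt0.
have T5 : (0 <= (C / (4 * Cp ^+ 2))%:E * q)%E by rewrite mule_ge0// lee_fin ltW.
(* If [Nd], [q] or [B0] is infinite, so is the right side; with [B0] finite, [HB] forces [Bm] to be
   finite. *)
case: Nd N0 Hdel T2 => [N N0 Hdel T2|_ _ _|//]; last first.
  have C1 : (0 < C^-1%:E :> \bar R)%E by rewrite lte_fin invr_gt0.
  rewrite expe2 mulyy gt0_muley// addey ?ninf//.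
  by rewrite !addye ?ninf// leey.
have HN := Hdel N erefl.
case: q q0 Hd T5 => [q q0 Hd T5|_ _ _|//]; last first.
  rewrite [X in (_ <= _ + X)%E]gt0_muley ?lte_fin// addey ?leey//.
  by apply: ninf; rewrite !adde_ge0// lee_fin.
case: B0 B00 HB T1 => [B0 B00 HB T1|_ _ _|//]; last first.
  by rewrite gt0_mulye ?lte_fin// !addye ?ninf// leey.
case: Bm Bm0 HB => [Bm Bm0 HB|_|//]; last by rewrite addye.
case: d Hd => [d Hd|//|_]; last first.
  by rewrite gt0_muleNy ?lte_fin// addNye leNye.
move: HB Hd; rewrite expe2 -!EFinM -!EFinD !lee_fin => HB Hd.
have H1 : C / (8 * Cp ^+ 2) * d <= C / 4 * e2 ^+ 2 + C / (4 * Cp ^+ 2) * q.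
  apply: (@le_trans _ _ (C / (8 * Cp ^+ 2) * (2 * (Cp * e2) ^+ 2 + 2 * q))).
    by rewrite ler_pM2l.
  rewrite le_eqVlt; apply/orP; left; apply/eqP; field.
  by rewrite gt_eqF.
have H2 : Bm / A + G <= B0 / A.
  rewrite -(ler_pM2r A0) mulrDl !divfK ?gt_eqF//.
  by rewrite [G * A]mulrC.
have H3 : - (C^-1 * (N * N)) - C / 4 * e2 ^+ 2 <= del.
  (* Young's inequality with the weight that costs C/4 e2^2, half of the coercive term. *)
  have : 0 <= C^-1 * (N - C / 2 * e2) ^+ 2 by rewrite mulr_ge0 ?sqr_ge0// invr_ge0 ltW.
  rewrite (_ : _ * _ = C^-1 * (N * N) - N * e2 + C / 4 * e2 ^+ 2); last first.
    by field; rewrite gt_eqF.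
  have := ler_norm (- del); rewrite normrN.
  by move: HN; move: (C^-1 * _) (C / 4 * _) (N * e2) `|del| => *; lra.
move: H1 H2 H3 HG; move: (Bm / A) (B0 / A) (C^-1 * _) (C / (4 * _) * q) (C / (8 * _) * d) => x y z w v.
rewrite (_ : 2^-1 * (C * e2 ^+ 2) = C / 4 * e2 ^+ 2 + C / 4 * e2 ^+ 2); last by field.
by move: (C / 4 * _) => s *; lra.
Qed.

Lemma adirBr (R : realType) (n : nat) (D : set 'rV[R]_n) (u v w : 'rV[R]_n -> R) :
  open D -> bounded_set D -> H1 D u -> H1 D v -> H1 D w ->
  adir D u (v \- w) = adir D u v - adir D u w.
Proof.
move=> oD bD Hu Hv Hw; rewrite (adir_linr oD bD (c := -1) Hu Hw Hv).
  by rewrite mulN1r addrC.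
by apply: ae_onW => x _ /=; rewrite mulN1r addrC.
Qed.

Lemma dgnorm_sqr_le (R : realType) (n : nat) (M : mesh R n) (v : 'rV[R]_n -> R) (c : R) :
  (dgnorm M v <= c%:E)%E -> (dgnorm M v ^+ 2 <= (c ^+ 2)%:E)%E.
Proof.
have := dgnorm_ge0 M v; move: (dgnorm M v) => x x0 xc.
by rewrite expe2 [in leRHS]expr2 EFinM; apply: lee_pmul.
Qed.

(** [K] is the variational inequality at v: [c], [i] stand for a(u,u), (f,u) and [d], [j] for
    a(u,v), (f,v). Comparing the discrete terms with v and u leaves c - i - (d - j), which is at
    most 0. *)
Lemma consistency_split (R : realType) (a b c d g h i j : R) : j - i <= d - c ->
  - (b - h - (a - g)) - `|a - c - (g - i)| <= `|b - d - (h - j)|.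
Proof.
move=> K; have := ler_norm (- (b - d - (h - j))); have := ler_norm (a - c - (g - i)).
by rewrite normrN; move: `|_| `|_| => r s *; lra.
Qed.

Lemma coercive_split (R : realType) (G x y s t del k l : R) :
  G = 2^-1 * x + del + s - t -> y <= x -> - (s - t) - l <= k ->
  2^-1 * y + del - k - l <= G.
Proof. by move=> -> *; lra. Qed.

Theorem corollary5p6 (R : realType) (n : nat) (n23 : n = 2%N \/ n = 3%N)
  (* problem data *)
  (Omega : set 'rV[R]_n) (Omega_open : open Omega)
  (Omega_bounded : bounded_set Omega) (Omega_lip : lipschitz_boundary Omega)
  (f phi u : 'rV[R]_n -> R) (f_L2 : L2 Omega f)
  (phi_H1 : H1 Omega phi)
  (phi_cont : {within closure Omega, continuous phi})
  (phi_bdry : forall x, (closure Omega `\` Omega) x -> phi x <= 0)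
  (u_sol : obstacle_solution Omega f phi u)
  (* Legendre function *)
  (Rf : 'rV[R]_n -> R -> \bar R)
  (Rf_legendre : legendre_integrand Omega phi Rf)
  (Rf_conj : conjugate_facts Omega phi Rf)
  (* mesh and spaces *)
  (M : mesh R n) (M_part : simplicial_partition M Omega)
  (sigma : R) (M_reg : shape_regular M sigma)
  (Vh : normedModType R) (Vh_fin : finite_dim Vh)
  (VT : set ('rV[R]_n -> R))
  (VT_sub : forall (c : R) v w, VT v -> VT w -> VT (fun x => c * v x + w x))
  (P0_VT : forall v, brokenP M Omega 0 v -> VT v)
  (VT_P1 : forall v, VT v -> brokenP M Omega 1 v)
  (p : Vh -> 'rV[R]_n -> R) (p_VT : forall v, VT (p v))
  (p_linear : forall (c : R) v w,
     ae_on Omega (fun x => p (c *: v + w) x = c * p v x + p w x))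
  (p_P0 : forall w, brokenP M Omega 0 w ->
     exists v, ae_on Omega (fun x => p v x = w x))
  (ah : Vh -> Vh -> R) (ah_bil : symmetric_bilinear ah)
  (* assumptions (i)-(iii) *)
  (Ccoerc Ccont Cp CPi : R)
  (Ccoerc_gt0 : 0 < Ccoerc) (Ccont_gt0 : 0 < Ccont)
  (Cp_gt0 : 0 < Cp) (CPi_gt0 : 0 < CPi)
  (ah_coerc : forall v, Ccoerc * `|v| ^+ 2 <= ah v v)
  (ah_cont : forall v z, ah v z <= Ccont * `|v| * `|z|)
  (p_bound : forall v, (dgnorm M (p v) <= (Cp * `|v|)%:E)%E)
  (Pi : ('rV[R]_n -> R) -> Vh)
  (Pi_linear : forall (c : R) v w, brokenH1 M Omega v -> brokenH1 M Omega w ->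
     Pi (fun x => c * v x + w x) = c *: Pi v + Pi w)
  (Pi_orth : forall v w, brokenH1 M Omega v -> brokenP M Omega 0 w ->
     ip Omega (p (Pi v) \- v) w = 0)
  (Pi_bound : forall v, brokenH1 M Omega v ->
     (`|Pi v|%R%:E <= CPi%:E * dgnorm M v)%E)
  (* iterates *)
  (alpha : nat -> R) (alpha_gt0 : forall k, (1 <= k)%N -> 0 < alpha k)
  (alpha_sum : (\sum_(1 <= k <oo) (alpha k)%:E = +oo)%E)
  (uh : nat -> Vh) (psi : nat -> 'rV[R]_n -> R)
  (psi_P0 : forall k, brokenP M Omega 0 (psi k))
  (iter1 : forall k, (1 <= k)%N -> forall v,
     ah (uh k) v + (alpha k)^-1 * ip Omega (p v) (psi k \- psi k.-1) =
     ip Omega f (p v))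
  (iter2 : forall k, (1 <= k)%N -> forall w, brokenP M Omega 0 w ->
     ip Omega (p (uh k)) w = ip Omega (dRs Rf (psi k)) w)
  (* conforming operator *)
  (Ch : ('rV[R]_n -> R) -> 'rV[R]_n -> R)
  (Ch_range : forall v, L2 Omega v ->
     brokenP M Omega 1 (Ch v) /\ H10 Omega (Ch v))
  (Ch_linear : forall (c : R) v w, L2 Omega v -> L2 Omega w ->
     ae_on Omega (fun x => Ch (fun y => c * v y + w y) x = c * Ch v x + Ch w x))
  (Ch_bounded : exists C : R, forall v, L2 Omega v ->
     H1sqr Omega (Ch v) <= C * ip Omega v v) :
  let o (k : nat) := dRs Rf (psi k) in
  let J (v : 'rV[R]_n -> R) := p (Pi v) in
  let delta (v : Vh) : R := ah (Pi u) v - adir Omega u (Ch (p v)) in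
  let eK (w : Vh) : R := inf [set `|adir Omega u (Ch (p w) \- v) - ip Omega f (p w \- v)|
                    | v in Kset Omega phi] in
  let eh : R := `|adir Omega u (Ch (J u) \- u) - ip Omega f (J u \- u)| in
  forall m, (1 <= m)%N ->
  let A : R := \sum_(1 <= k < m.+1) alpha k in
  ((Ccoerc / (8 * Cp ^+ 2))%R%:E * dgnorm M (p (uh m) \- u)%R ^+ 2 +
     bregman_int Omega Rf u (o m) * A^-1%R%:E
   <= bregman_int Omega Rf u (o 0%N) * A^-1%R%:E +
      Ccoerc^-1%R%:E * dual_norm delta ^+ 2 + (eK (uh m))%:E + eh%:E +
      (Ccoerc / (4 * Cp ^+ 2))%R%:E * dgnorm M (u \- J u)%R ^+ 2)%E.
Proof.
move=> o J delta eK eh m m1; cbv zeta; set A := \sum_(1 <= k < m.+1) alpha k.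
have mO : measurable Omega by exact: open_measurable_rV.
have fO : (leb R n Omega < +oo)%E by exact: leb_bounded_lty.
have [[[Hu _] phiu] uvi] := u_sol.
have Lu : L2 Omega u by case: Hu.
have pL2 v : L2 Omega (p v) by exact: (brokenP_L2 Omega_open Omega_bounded M_part (VT_P1 _ (p_VT v))).
have psiI k : Linfty Omega (psi k) by exact: (brokenP_Linfty Omega_bounded M_part (psi_P0 k)).
have psiL k : L2 Omega (psi k) by exact: (Linfty_L2 mO fO (psiI k)).
have oL k : L2 Omega (o k) by case: (conj_map Rf_conj (psiI k)).
have ub : brokenH1 M Omega u by exact: (H1_brokenH1 Omega_open Omega_lip M_part Hu).
have wP0 k : brokenP M Omega 0 (psi k \- psi k.-1).
  have := brokenP_lin (-1) (psi_P0 k.-1) (psi_P0 k).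
  by congr brokenP; apply/funext => x /=; rewrite mulN1r addrC.
have wL k : L2 Omega (psi k \- psi k.-1) by exact: (L2B mO (psiL k) (psiL k.-1)).
have a0 v : 0 <= ah v v.
  by apply: le_trans (ah_coerc v); rewrite mulr_ge0 ?sqr_ge0// ltW.
have K2 k j : (1 <= k)%N -> (1 <= j)%N ->
    ip Omega (p (uh k)) (psi j \- psi j.-1) = ip Omega (o k) (psi j \- psi j.-1).
  by move=> k1 _; exact: iter2.
have Ko k : (1 <= k)%N ->
    ip Omega (p (Pi u)) (psi k \- psi k.-1) = ip Omega u (psi k \- psi k.-1).
  move=> _; have := Pi_orth u _ ub (wP0 k).
  by rewrite ipBl// => /eqP; rewrite subr_eq0 => /eqP.
have Km k : (1 <= k)%N -> 0 <= ip Omega (o k \- o k.-1) (psi k \- psi k.-1).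
  by move=> _; exact: (dRs_mono mO Rf_conj).
pose B k := bregman_int Omega Rf u (o k).
have B0 k : (0 <= B k)%E by exact: (bregman_int_ge0 mO Rf_legendre Rf_conj).
have KB k : (1 <= k)%N ->
    (B k + (ip Omega (psi k \- psi k.-1) (u \- o k))%:E <= B k.-1)%E.
  by move=> _; exact: (bregman_int_step mO fO Rf_legendre Rf_conj).
have HB := bregman_energy (U := Pi u) mO ah_bil a0 psiL oL Lu alpha_gt0
  iter1 K2 Ko Km KB (leqnn m).
set G := energy _ _ _ _ _ - _ in HB.
have A0 : 0 < A.
  rewrite /A big_nat_recr//= ltr_wpDl// ?alpha_gt0//.
  by rewrite big_nat; apply: sumr_ge0 => k /andP[k1 _]; rewrite ltW// alpha_gt0.
have ChH1 v : L2 Omega v -> H1 Omega (Ch v) by move=> /Ch_range[_ []].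
pose L v := adir Omega u (Ch (p v)).
have Llin (c : R) v w : L (c *: v + w) = c * L v + L w.
  exact: (adir_Ch_linear Omega_open Omega_bounded p_linear pL2 ChH1 Ch_linear Ch_bounded).
have dlin (c : R) v w : delta (c *: v + w) = c * delta v + delta w.
  rewrite /delta -!/(L _) Llin (sbilC ah_bil) (sbil_lin ah_bil).
  by rewrite !(sbilC ah_bil _ (Pi u)); move: (L v) (L w) (ah _ v) (ah _ w) => *; ring.
(* The difference is written in the shape [c *: v + w] in which linearity is available. *)
pose e := -1 *: Pi u + uh m.
(* Lower bounds pass to the real infimum because the set is nonempty: [u] itself belongs to K. *)
have eKge x : (forall v, Kset Omega phi v ->
      x <= `|adir Omega u (Ch (p (uh m)) \- v) - ip Omega f (p (uh m) \- v)|) ->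
    x <= eK (uh m).
  move=> H; apply: lb_le_inf; last by move=> _ [v Kv <-]; exact: H.
  by eexists; exists u; first by case: u_sol.
have eK0 : 0 <= eK (uh m) by apply: eKge => v _; exact: normr_ge0.
(* Expanding the energy around [Pi u] gives a_h(Pi u, e) - (f, p e); adding and subtracting a(u, C_h
   p e) isolates delta(e). *)
have GE : G = 2^-1 * ah e e + delta e + (L (uh m) - ip Omega f (p (uh m))) -
    (L (Pi u) - ip Omega f (p (Pi u))).
  rewrite /e (sbil_sqr ah_bil) dlin /delta -!/(L _) (sbilC ah_bil (Pi u) (uh m)) /G /energy.
  move: (L _) (L _) (ip Omega f _) (ip Omega f _) (ah _ _) (ah _ _) (ah _ _) => *.
  by field.
have HG : 2^-1 * (Ccoerc * `|e| ^+ 2) + delta e - eK (uh m) - eh <= G.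
  have Hce := ah_coerc e.
  have HK : - ((L (uh m) - ip Omega f (p (uh m))) - (L (Pi u) - ip Omega f (p (Pi u)))) - eh
      <= eK (uh m).
    apply: eKge => v Kv; have Hv : H1 Omega v by case: Kv => -[].
    have Lv : L2 Omega v by case: Hv.
    have Cm := ChH1 _ (pL2 (uh m)); have CP := ChH1 _ (pL2 (Pi u)).
    have := uvi v Kv; rewrite /eh /J.
    rewrite !(adirBr Omega_open Omega_bounded)// !ipBr// -!/(L _).
    move: (L _) (L _) (adir _ _ _) (adir _ _ _) (ip _ _ _) (ip _ _ _) (ip _ _ _) (ip _ _ _).
    by move=> a b c d g h i j; exact: consistency_split.
  exact: coercive_split GE Hce HK.
(* On each cell, p(u_h^m) - u = p e - (u - J u) almost everywhere. *)
have Hdg : (dgnorm M (p (uh m) \- u)%R ^+ 2 <=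
    2%:E * dgnorm M (p e) ^+ 2 + 2%:E * dgnorm M (u \- J u)%R ^+ 2)%E.
  apply: dgnorm_sub_le => T TM.
  have oT : open (cell T) by exact: cell_open.
  have TO := cell_sub Omega_lip M_part TM.
  have bT := bounded_set_sub TO Omega_bounded.
  have HpT v : H1 (cell T) (p v).
    exact: (brokenP_H1 Omega_open Omega_bounded Omega_lip M_part (VT_P1 _ (p_VT v)) TM).
  split => //.
    exact: (H1B oT bT (H1_restrict oT Omega_open TO Hu) (HpT (Pi u))).
  apply: ae_onS (ae_on_sub TO (p_linear (-1) (Pi u) (uh m))) => x _ /= ->.
  by rewrite /J; ring.
have Hd := dgnorm_sqr_le (p_bound e).
have Hd2 : (dgnorm M (p (uh m) \- u)%R ^+ 2 <=
    2%:E * ((Cp * `|e|) ^+ 2)%:E + 2%:E * dgnorm M (u \- J u)%R ^+ 2)%E.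
  by apply: (le_trans Hdg); apply: leeD2r; exact: lee_wpmul2l Hd.
have q0 : (0 <= dgnorm M (u \- J u)%R ^+ 2)%E.
  by apply: expe_ge0; exact: dgnorm_ge0.
have Hdel N : dual_norm delta = N%:E -> `|delta e| <= N * `|e|.
  by move=> dN; exact: dual_norm_le dlin dN e.
have eh0 : 0 <= eh by exact: normr_ge0.
exact: (error_bound_arith Ccoerc_gt0 Cp_gt0 A0 (normr_ge0 e) eK0 eh0
  (dual_norm_ge0 delta) (B0 m) (B0 0%N) q0 HB HG Hdel Hd2).
Qed.
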